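(* Let $L:L^2(\mathbb{R})\to L^\infty(\mathbb{R})$ be an analog filter with transfer function $H$, and assume that $H(\mathbb{R})\subseteq\mathbb{R}$ (i.e. $H$ is real valued). Then $d(L,\mathbf{CF_a})=\frac{1}{\sqrt{2}}\|L\|$ and the angle determined by $L$ and $\mathbf{CF_a}$ is $\pi/4$.
   Context: Signals are complex valued. The Fourier transform $\mathcal{F}:L^2(\mathbb{R})\to L^2(\mathbb{R})$ is the unitary operator given by $\mathcal{F}(x)(w)=\frac{1}{\sqrt{2\pi}}\int_{-\infty}^{\infty}x(t)e^{-iwt}\,dt$, with inverse $\mathcal{F}^{-1}(x)(t)=\frac{1}{\sqrt{2\pi}}\int_{-\infty}^{\infty}x(w)e^{iwt}\,dw$. $\mathbf{F_a}$ is the normed space (with the operator norm) of analog filters, i.e. bounded linear operators $L:L^2(\mathbb{R})\to L^\infty(\mathbb{R})$ commuting with all translations. Every $L\in\mathbf{F_a}$ is of the form $L=L_h$ for a unique $h\in L^2(\mathbb{R})$, where $L_h(x)=x*h$, $(x*h)(t)=\int_{-\infty}^{\infty}x(s)h(t-s)\,ds$; moreover $\|L_h\|=\|h\|_{L^2}$, and $\mathbf{F_a}$ is a Hilbert space with $\langle L_h,L_g\rangle=\langle h,g\rangle_{L^2}$. The transfer function of $L_h$ is $H=\mathcal{F}(h)\in L^2(\mathbb{R})$. $\mathbf{CF_a}$ (the space of causal analog filters) is the set of all $L_h$, $h\in L^2(\mathbb{R})$, with $h=0$ a.e. on $(-\infty,0)$. The distance is $d(L,M)=\inf_{K\in M}\|L-K\|$,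 and the angle determined by a filter $L$ and a closed subspace $M$ of $\mathbf{F_a}$ is $\arcsin\big(d(L,M)/\|L\|\big)$. *)

(* Defs.v *)
From HB Require Import structures.
From mathcomp Require Import all_boot all_order all_algebra.
From mathcomp Require Import complex.
From mathcomp Require Import all_classical all_reals all_analysis.

Set Implicit Arguments.
Unset Strict Implicit.
Unset Printing Implicit Defensive.

Import Order.TTheory GRing.Theory Num.Theory.
Import numFieldNormedType.Exports.

Local Open Scope classical_set_scope.
Local Open Scope ring_scope.
Local Open Scope complex_scope.

Section Signals.
Variable R : realType.
Local Notation mu := (@lebesgue_measure R).
Implicit Types (f g h x y H : R -> R[i]) (p : \bar R).

Definition cnorm p f : \bar R :=
  Lnorm mu p (fun t => (ComplexField.Normc.normc (f t))%:E).

(* Elements of L^p(R) are handled through representatives: everything below is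
   invariant under a.e. equality, and equality of elements of L^p is
   [f = g %[ae mu]]. *)
Definition isLp p f : Prop :=
  [/\ measurable_fun setT (fun t => complex.Re (f t)),
      measurable_fun setT (fun t => complex.Im (f t)) &
      (cnorm p f < +oo)%E].

Definition cintegral (D : set R) f : R[i] :=
  (\int[mu]_(t in D) complex.Re (f t)) +i* (\int[mu]_(t in D) complex.Im (f t)).

Definition conv x h : R -> R[i] :=
  fun t => cintegral setT (fun s => x s * h (t - s)).

Definition translate (s : R) x : R -> R[i] := fun t => x (t - s).

(* (2 pi)^(-1/2) times the integral of x(t) exp(- i w t) over [-a, a] *)
Definition truncated_fourier (a : R) x : R -> R[i] :=
  fun w => ((Num.sqrt (2 * pi))^-1)%:C *
    cintegral `[- a, a] (fun t => x t * (cos (w * t) -i* sin (w * t))).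

(* [X = F(x)] in L^2(R). For x in L^2(R) the Fourier integral need not converge
   absolutely; it is the limit in L^2(R) of the integrals over [-n, n]. *)
Definition is_fourier x (X : R -> R[i]) : Prop :=
  isLp 2%:E X /\
  (fun n : nat => cnorm 2%:E (fun w => X w - truncated_fourier n%:R x w))
    @ \oo --> 0%E.

(* Bounded linear operators L^2(R) -> L^oo(R) commuting with translations. The
   values of the underlying function outside L^2(R) are irrelevant. *)
Record analogFilter := AnalogFilter {
  filter_fun :> (R -> R[i]) -> (R -> R[i]);
  filter_Loo : forall x, isLp 2%:E x -> isLp +oo%E (filter_fun x);
  filter_ae : forall x y, isLp 2%:E x -> isLp 2%:E y ->
    x = y %[ae mu] -> filter_fun x = filter_fun y %[ae mu];
  filter_linear : forall (a : R[i]) x y, isLp 2%:E x -> isLp 2%:E y ->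
    filter_fun (fun t => a * x t + y t) =
      (fun t => a * filter_fun x t + filter_fun y t) %[ae mu];
  filter_bounded : exists C : R, forall x, isLp 2%:E x ->
    (cnorm +oo (filter_fun x) <= C%:E * cnorm 2%:E x)%E;
  filter_translate : forall (s : R) x, isLp 2%:E x ->
    filter_fun (translate s x) = translate s (filter_fun x) %[ae mu] }.

Definition opnorm (T : (R -> R[i]) -> (R -> R[i])) : \bar R :=
  ereal_sup [set cnorm +oo%E (T x) |
             x in [set x | isLp 2%:E x /\ (cnorm 2%:E x <= 1)%E]].

(* [L = L_h] as operators on L^2(R) *)
Definition is_conv_filter (L : analogFilter) h : Prop :=
  forall x, isLp 2%:E x -> L x = conv x h %[ae mu].

Definition is_transfer_function (L : analogFilter) H : Prop :=
  exists h, [/\ isLp 2%:E h, is_conv_filter L h & is_fourier h H].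

Definition CFa : set analogFilter :=
  [set L | exists h, [/\ isLp 2%:E h,
    (\forall t \ae mu, t < 0 -> h t = 0) & is_conv_filter L h]].

Definition filter_dist (L : analogFilter) (M : set analogFilter) : \bar R :=
  ereal_inf [set opnorm (fun x t => L x t - K x t) | K in M].

(* Meaningful only when [opnorm L] is nonzero. *)
Definition filter_angle (L : analogFilter) (M : set analogFilter) : R :=
  asin (fine (filter_dist L M) / fine (opnorm L)).

End Signals.

Arguments CFa R : clear implicits.

(* Main.v *)
From Pilot Require Import Defs.
From HB Require Import structures.
From mathcomp Require Import all_boot all_order all_algebra.
From mathcomp Require Import complex.
From mathcomp Require Import all_classical all_reals all_analysis.
From mathcomp Require Import measurable_realfun ess_sup_inf ring lra.

(** A filter with impulse response [h] has operator norm [|| h ||_2], so the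
    distance to the causal filters is a distance in L^2: it is attained by
    cutting [h] off on the negative half-line, and it equals the square root of
    the energy of [h] there ([filter_dist_causal]). A real transfer function
    makes [h] Hermitian, [h (- t) = conj (h t)], so this energy is half of the
    total one; the distance is [|| h ||_2 / sqrt 2] and the angle is
    [arcsin (1 / sqrt 2) = pi / 4]. Two analytic facts support this.

    The operator norm ([opnorm_conv]). The upper bound is Cauchy-Schwarz. For the
    lower bound, the input [conj (h (- t))] produces the output [|| h ||_2 ^ 2]
    at time 0, but the essential supremum ignores a single time. So [h] is
    replaced in the input by a bounded truncation [b] of compact support, and the
    output is averaged over small intervals around 0; Fubini moves the average
    onto [b], where Lebesgue differentiation gives the limit.

    The symmetry ([fourier_real_symmetry]). The claim is that the Fourier transform
    is injective on the part of [h] that a real transform kills. By scaling, the integral of [(1 - cos (t w)) / w ^ 2] over the line is a positive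
    multiple of [|t|], so the cosine transform of the integrable function
    [(1 - cos (d w)) / w ^ 2] is a tent of width [d], up to a constant. Pairing
    the imaginary parts of the truncated transforms, which tend to 0 in L^2, with
    modulations of this function shows that [Im h (t) + Im h (- t)] and
    [Re h (t) - Re h (- t)] are orthogonal to every tent, hence vanish at their
    Lebesgue points ([tent_separates]). *)

Set Implicit Arguments.
Unset Strict Implicit.
Unset Printing Implicit Defensive.

Import Order.TTheory GRing.Theory Num.Theory.
Import numFieldNormedType.Exports.
(* Otherwise [conv] would denote convex combinations. *)
Import Pilot.Defs.

Local Open Scope classical_set_scope.
Local Open Scope ring_scope.
Local Open Scope complex_scope.

(** * Real Lebesgue integrals and affine changes of variables *)

Section Integrals.
Context {R : realType}.
Notation mu := (@lebesgue_measure R).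
Implicit Types (f g : R -> R).

(* Type class search does not see through the carrier of [lebesgue_measure]. *)
#[global] Instance ae_mu_filter : Filter (nbhs (almost_everywhere mu)).
Proof. exact: ae_filter_ringOfSetsType. Qed.

Definition rint (f : R -> R) := mu.-integrable setT (EFin \o f).

Lemma rint_measurable f : rint f -> measurable_fun setT f.
Proof. by move=> /measurable_int /measurable_EFinP. Qed.

Lemma rint_le f g : measurable_fun setT f -> (forall x, `|f x| <= g x) ->
  rint g -> rint f.
Proof.
move=> mf fg ig; apply: le_integrable ig => //; first exact/measurable_EFinP.
move=> x _ /=; rewrite lee_fin; apply: (le_trans (fg x)); exact: ler_norm.
Qed.

Lemma rintD f g : rint f -> rint g -> rint (fun x => f x + g x).
Proof. by move=> fi gi; have := integrableD measurableT fi gi. Qed.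

Lemma rintZ a f : rint f -> rint (fun x => a * f x).
Proof. by move=> fi; have := integrableZl measurableT a fi. Qed.

Lemma rintN f : rint f -> rint (fun x => - f x).
Proof. by move=> fi; have := integrableN fi. Qed.

Lemma rintB f g : rint f -> rint g -> rint (fun x => f x - g x).
Proof. by move=> fi gi; apply: rintD => //; apply: rintN. Qed.

Lemma rint_norm f : rint f -> rint (fun x => `|f x|).
Proof. by move=> fi; have := integrable_abse fi. Qed.

Lemma rintM_bounded f g M : rint f -> measurable_fun setT g ->
  (forall x, `|g x| <= M) -> rint (fun x => f x * g x).
Proof.
move=> fi mg gM; apply: (@rint_le _ (fun x => M * `|f x|)).
- by apply: measurable_funM => //; exact: rint_measurable.
- by move=> x; rewrite normrM mulrC ler_wpM2r.
- by apply: rintZ; exact: rint_norm.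
Qed.

Lemma rint_EFin f : rint f -> (\int[mu]_x (f x)%:E)%E = (\int[mu]_x f x)%:E.
Proof. by move=> fi; rewrite /Rintegral fineK// integrable_fin_num. Qed.

Lemma ae_eq_Rint f g : measurable_fun setT f -> measurable_fun setT g ->
  {ae mu, forall x, f x = g x} -> \int[mu]_x f x = \int[mu]_x g x.
Proof.
move=> mf mg fg; congr fine; apply: ae_eq_integral => //; try exact/measurable_EFinP.
by apply: filterS fg => x fgx _ /=; rewrite fgx.
Qed.

Lemma le_Rint_ae f g : rint f -> rint g ->
  {ae mu, forall x, f x <= g x} -> \int[mu]_x f x <= \int[mu]_x g x.
Proof.
move=> fi gi fg.
have mf := rint_measurable fi; have mg := rint_measurable gi.
have -> : \int[mu]_x f x = \int[mu]_x Num.min (f x) (g x).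
  apply: ae_eq_Rint => //; first exact: measurable_minr.
  by apply: filterS fg => x fgx; rewrite min_l.
apply: le_Rintegral => //.
- apply: (@rint_le _ (fun x => `|f x| + `|g x|)).
  + exact: measurable_minr.
  + by move=> x; rewrite /Num.min; case: ifP => _; rewrite ?lerDl ?lerDr.
  + by apply: rintD; exact: rint_norm.
- by move=> x _; rewrite ge_min lexx orbT.
Qed.

Lemma Rint_eq0 f : (forall x, f x = 0) -> \int[mu]_x f x = 0.
Proof. by move=> f0; rewrite /Rintegral integral0_eq// => x _; rewrite f0. Qed.

Lemma abse_Rint f : rint f -> `|\int[mu]_x f x| <= \int[mu]_x `|f x|.
Proof. by move=> fi; exact: le_normr_Rintegral. Qed.

Definition affine (a b : R) : R -> measurableTypeR R := fun x => a * x + b.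

Lemma measurable_affine a b : measurable_fun setT (affine a b).
Proof. by apply: measurable_funD => //; exact: measurable_funM. Qed.

HB.instance Definition _ a b :=
  isMeasurableFun.Build _ _ _ _ (affine a b) (measurable_affine a b).

(** Both sides are measures that agree on half-open intervals. *)
Lemma lebesgue_measure_affine (a b : R) (A : set R) : 0 < a -> measurable A ->
  mu A = (a%:E * pushforward mu (affine a b) A)%E.
Proof.
move=> a0 mA.
pose a' : {nonneg R} := NngNum (ltW a0).
pose nu : {measure set (measurableTypeR R) -> \bar R} :=
  mscale a' (pushforward mu (affine a b)).
apply: (@lebesgue_measure_unique R (nu (measurable_affine a b))) => // _ [[c d]] _ <-.
rewrite /nu /= /mscale /= /pushforward /=.
rewrite (_ : _ @^-1` _ = `](c - b) / a, (d - b) / a]%classic); last first.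
  apply/seteqP; split => x /=; rewrite !in_itv /= ltr_pdivrMr// ler_pdivlMr//.
    by rewrite ltrBlDr lerBrDr mulrC.
  by rewrite ltrBlDr lerBrDr mulrC.
rewrite !lebesgue_measure_itv/= !lte_fin ltr_pM2r ?invr_gt0// ltrD2r.
case: ifPn => cd; last by rewrite mule0.
rewrite -!EFinB -EFinM; congr EFin; field; exact: lt0r_neq0.
Qed.

Lemma ge0_integral_affine (a b : R) (f : R -> \bar R) : 0 < a ->
  measurable_fun setT f -> (forall x, 0 <= f x)%E ->
  (\int[mu]_x f x = a%:E * \int[mu]_x f (a * x + b)%R)%E.
Proof.
move=> a0 mf f0.
pose a' : {nonneg R} := NngNum (ltW a0).
pose nu' : {measure set (measurableTypeR R) -> \bar R} :=
  pushforward mu (affine a b).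
pose nu := nu' (measurable_affine a b).
transitivity (\int[mscale a' nu]_x f x)%E.
  by apply: eq_measure_integral => A mA _; exact: lebesgue_measure_affine.
rewrite ge0_integral_mscale//; congr (_ * _)%E.
by rewrite ge0_integral_pushforward//; exact: measurable_affine.
Qed.

Lemma integral_shift (b : R) (f : R -> \bar R) : measurable_fun setT f ->
  (\int[mu]_x f (x + b)%R = \int[mu]_x f x)%E.
Proof.
move=> mf; rewrite [LHS]integralE [RHS]integralE; congr (_ - _)%E; apply/esym.
- rewrite (@ge0_integral_affine 1 b)//; last exact: measurable_funepos.
  by rewrite mul1e; apply: eq_integral => x _; rewrite mul1r !funeposE.
- rewrite (@ge0_integral_affine 1 b)//; last exact: measurable_funeneg.
  by rewrite mul1e; apply: eq_integral => x _; rewrite mul1r !funenegE.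
Qed.

Lemma integral_reflect (f : R -> \bar R) : measurable_fun setT f ->
  (\int[mu]_x f (- x)%R = \int[mu]_x f x)%E.
Proof.
move=> mf.
have ge0 (g : R -> \bar R) : measurable_fun setT g -> (forall x, 0 <= g x)%E ->
    (\int[mu]_x g (- x)%R = \int[mu]_x g x)%E.
  move=> mg g0.
  have mN : measurable_fun setT (-%R : R -> measurableTypeR R) by [].
  transitivity (\int[pushforward mu (-%R : R -> measurableTypeR R)]_x g x)%E.
    by rewrite ge0_integral_pushforward.
  by apply: eq_measure_integral => //= A mA _; exact: lebesgue_measureN.
rewrite [LHS]integralE [RHS]integralE; congr (_ - _)%E.
- rewrite -(ge0 f^\+%E)//; last exact: measurable_funepos.
  by apply: eq_integral => x _; rewrite !funeposE.
- rewrite -(ge0 f^\-%E)//; last exact: measurable_funeneg.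
  by apply: eq_integral => x _; rewrite !funenegE.
Qed.

Lemma Rint_shift b f : measurable_fun setT f ->
  \int[mu]_x f (x + b) = \int[mu]_x f x.
Proof.
move=> mf; congr fine; have := @integral_shift b (EFin \o f); apply.
exact/measurable_EFinP.
Qed.

Lemma Rint_reflect f : measurable_fun setT f ->
  \int[mu]_x f (- x) = \int[mu]_x f x.
Proof.
move=> mf; congr fine; have := @integral_reflect (EFin \o f); apply.
exact/measurable_EFinP.
Qed.

Lemma Rint_subr (a : R) f : measurable_fun setT f ->
  \int[mu]_x f (a - x) = \int[mu]_x f x.
Proof.
move=> mf; rewrite -[RHS](Rint_shift a)// -[RHS]Rint_reflect.
  by apply: eq_Rintegral => x _; rewrite addrC.
by apply: (measurableT_comp mf); exact: measurable_funD.
Qed.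

Lemma rint_shift b f : rint f -> rint (fun x => f (x + b)).
Proof.
move=> fi; have mf := rint_measurable fi; apply/integrableP; split.
  apply/measurable_EFinP; apply: (@measurableT_comp _ _ _ _ _ _ f) => //.
  by apply: measurable_funD.
have /= -> := @integral_shift b (fun x => `|(f x)%:E|%E).
  by have /integrableP[] := fi.
by do 2 apply: measurableT_comp => //.
Qed.

Lemma rint_reflect f : rint f -> rint (fun x => f (- x)).
Proof.
move=> fi; have mf := rint_measurable fi; apply/integrableP; split.
  by apply/measurable_EFinP; apply: (@measurableT_comp _ _ _ _ _ _ f).
have /= -> := @integral_reflect (fun x => `|(f x)%:E|%E).
  by have /integrableP[] := fi.
by do 2 apply: measurableT_comp => //.
Qed.

End Integrals.

(** * Exchanging integrals *)

Section Fubini.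
Context {R : realType}.
Notation mu := (@lebesgue_measure R).
Implicit Types (f g : R -> R).

(** The integral is the difference of the integrals of the positive and negative
    parts, to which Tonelli applies even where a section is not integrable. *)
Lemma measurable_Rint_param (F : R * R -> R) : measurable_fun setT F ->
  measurable_fun setT (fun x => \int[mu]_y F (x, y)).
Proof.
move=> mF.
have mG : measurable_fun setT (EFin \o F) by exact/measurable_EFinP.
apply: (measurableT_comp (f := fine)) => //.
rewrite (_ : (fun x => _) = (fun x => (\int[mu]_y (EFin \o F)^\+ (x, y))
    - (\int[mu]_y (EFin \o F)^\- (x, y)))%E); last first.
  apply/funext => x; rewrite [LHS]integralE; congr (_ - _)%E.
    by apply: eq_integral => y _; rewrite !funeposE.
  by apply: eq_integral => y _; rewrite !funenegE.
apply: emeasurable_funB.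
  by apply: (measurable_fun_fubini_tonelli_F (m2 := mu) (EFin \o F)^\+%E) => //;
    exact: measurable_funepos.
by apply: (measurable_fun_fubini_tonelli_F (m2 := mu) (EFin \o F)^\-%E) => //;
  exact: measurable_funeneg.
Qed.

Lemma measurable_section (F : R * R -> R) x : measurable_fun setT F ->
  measurable_fun setT (fun y => F (x, y)).
Proof. by move=> mF; apply: measurableT_comp => //; exact: pair1_measurable. Qed.

Lemma measurable_section2 (F : R * R -> R) y : measurable_fun setT F ->
  measurable_fun setT (fun x => F (x, y)).
Proof. by move=> mF; apply: measurableT_comp => //; exact: pair2_measurable. Qed.

(** The form of Fubini's theorem used throughout: the product of two integrable
    functions of one variable dominates, and [K] carries the coupling. *)
Lemma Rint_swap f g (K : R * R -> R) M : rint f -> rint g ->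
  measurable_fun setT K -> (forall z, `|K z| <= M) ->
  rint (fun x => f x * \int[mu]_y (g y * K (x, y))) /\
  \int[mu]_x (f x * \int[mu]_y (g y * K (x, y))) =
  \int[mu]_y (g y * \int[mu]_x (f x * K (x, y))).
Proof.
move=> fi gi mK KM.
have mf := rint_measurable fi; have mg := rint_measurable gi.
pose F (z : R * R) := ((f z.1 * g z.2) * K z)%:E.
have mF : measurable_fun setT F.
  apply/measurable_EFinP; apply: measurable_funM => //; apply: measurable_funM.
    by apply: (@measurableT_comp _ _ _ _ _ _ f) => //; exact: measurable_fst.
  by apply: (@measurableT_comp _ _ _ _ _ _ g) => //; exact: measurable_snd.
have gKi x : rint (fun y => g y * K (x, y)).
  by apply: (@rintM_bounded _ _ _ M) => //; exact: measurable_section.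
have fKi y : rint (fun x => f x * K (x, y)).
  by apply: (@rintM_bounded _ _ _ M) => //; exact: measurable_section2.
have M0 : 0 <= M by exact: le_trans (KM (0, 0)).
have inner1 x : (\int[mu]_y F (x, y) = (f x * \int[mu]_y (g y * K (x, y)))%:E)%E.
  rewrite -RintegralZl//; last exact: gKi.
  rewrite -rint_EFin; last by apply: rintZ.
  by apply: eq_integral => y _; rewrite /F /= mulrA.
have inner2 y : (\int[mu]_x F (x, y) = (g y * \int[mu]_x (f x * K (x, y)))%:E)%E.
  rewrite -RintegralZl//; last exact: fKi.
  rewrite -rint_EFin; last by apply: rintZ.
  by apply: eq_integral => x _; rewrite /F /= mulrA [g y * _]mulrC.
have iF : (mu \x mu)%E.-integrable setT F.
  apply/integrable12ltyP => //.
  apply: (@le_lt_trans _ _ (\int[mu]_x (M * \int[mu]_y `|g y| * `|f x|)%:E)%E).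
    apply: ge0_le_integral => //.
    - by move=> x _; exact: integral_ge0.
    - apply: (measurable_fun_fubini_tonelli_F (m2 := mu) (fun z => `|F z|)%E) => //.
      exact: measurableT_comp.
    - apply/measurable_EFinP; apply: measurable_funM => //.
      exact: measurableT_comp.
    - move=> x _.
      apply: (@le_trans _ _ (\int[mu]_y (M * `|f x| * `|g y|)%:E)%E).
        apply: ge0_le_integral => //.
        - apply: measurableT_comp => //.
          by apply: measurableT_comp => //; exact: pair1_measurable.
        - apply/measurable_EFinP; apply: measurable_funM => //.
          exact: measurableT_comp.
        - move=> y _; rewrite /F /= lee_fin !normrM mulrC -mulrA.
          by apply: ler_wpM2r => //; exact: mulr_ge0.
      rewrite rint_EFin; last by apply: rintZ; exact: rint_norm.
      rewrite RintegralZl//; last exact: rint_norm.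
      by rewrite lee_fin -!mulrA ler_wpM2l// mulrC.
  rewrite rint_EFin ?ltry//.
  by apply: rintZ; exact: rint_norm.
split.
  have := integrable_fubini_F iF; apply: eq_integrable => //.
  by move=> x _; rewrite /fubini_F inner1.
congr fine; transitivity (\int[mu]_x \int[mu]_y F (x, y))%E.
  by apply: eq_integral => x _; rewrite inner1.
transitivity (\int[mu]_y \int[mu]_x F (x, y))%E; first exact: (Fubini iF).
by apply: eq_integral => y _; rewrite inner2.
Qed.

End Fubini.

(** * Square-integrable functions and the Cauchy-Schwarz inequality *)

Section SquareIntegrable.
Context {R : realType}.
Notation mu := (@lebesgue_measure R).
Implicit Types (f g : R -> R).

Definition sqint f := measurable_fun setT f /\ rint (fun x => f x ^+ 2).

Lemma sqint_le f g : measurable_fun setT f -> (forall x, `|f x| <= `|g x|) ->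
  sqint g -> sqint f.
Proof.
move=> mf fg [mg gi]; split => //; apply: rint_le gi => [|x].
  exact: measurable_funX.
by rewrite normrX -[leRHS]real_normK ?num_real// lerXn2r// ?nnegrE.
Qed.

Lemma sqint_mul f g : sqint f -> sqint g -> rint (fun x => f x * g x).
Proof.
move=> [mf fi] [mg gi]; apply: rint_le (rintD fi gi) => [|x].
  exact: measurable_funM.
rewrite normrM -[f x ^+ 2]real_normK ?num_real// -[g x ^+ 2]real_normK ?num_real//.
have := sqr_ge0 (`|f x| - `|g x|); have := normr_ge0 (f x); have := normr_ge0 (g x).
nra.
Qed.

Lemma sqintZ a f : sqint f -> sqint (fun x => a * f x).
Proof.
move=> [mf fi]; split; first exact: measurable_funM.
by rewrite (_ : (fun x => _) = (fun x => a ^+ 2 * f x ^+ 2));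
  [exact: rintZ|apply/funext => x; rewrite exprMn].
Qed.

Lemma sqintN f : sqint f -> sqint (fun x => - f x).
Proof.
by move=> sf; have [mf _] := sf; apply: sqint_le sf => [|x];
  [exact: measurableT_comp|rewrite normrN]. Qed.

Lemma sqintD f g : sqint f -> sqint g -> sqint (fun x => f x + g x).
Proof.
move=> sf sg; have [mf fi] := sf; have [mg gi] := sg.
split; first exact: measurable_funD.
rewrite (_ : (fun x => _) = (fun x => f x ^+ 2 + (2 * (f x * g x) + g x ^+ 2))).
  by apply: rintD => //; apply: rintD => //; apply: rintZ; exact: sqint_mul.
by apply/funext => x; ring.
Qed.

Lemma sqintB f g : sqint f -> sqint g -> sqint (fun x => f x - g x).
Proof. by move=> sf sg; apply: sqintD => //; exact: sqintN. Qed.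

Lemma sqint_reflect f : sqint f -> sqint (fun x => f (- x)).
Proof.
move=> [mf fi]; split; first by apply: (@measurableT_comp _ _ _ _ _ _ f).
by have := rint_reflect fi.
Qed.

Lemma sqint_shift a f : sqint f -> sqint (fun x => f (x + a)).
Proof.
move=> [mf fi]; split; last by have := rint_shift a fi.
by apply: (@measurableT_comp _ _ _ _ _ _ f) => //; apply: measurable_funD.
Qed.

Lemma sqint_subr a f : sqint f -> sqint (fun x => f (a - x)).
Proof.
move=> /(sqint_shift a) /sqint_reflect; congr sqint.
by apply/funext => x; rewrite addrC.
Qed.

Lemma sqint_indic f (A : set R) : measurable A -> sqint f ->
  sqint (fun x => f x * \1_A x).
Proof.
move=> mA sf; have [mf _] := sf; apply: sqint_le sf => [|x].
  exact: measurable_funM.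
by rewrite normrM indicE; case: (_ \in _); rewrite ?normr1 ?mulr1// normr0 mulr0.
Qed.

Lemma rint_bounded_sqint f M : rint f -> (forall x, `|f x| <= M) -> sqint f.
Proof.
move=> fi fM; split; first exact: rint_measurable.
by have := rintM_bounded fi (rint_measurable fi) fM.
Qed.

(** The value at [(B, - C)] decides, or at [(C, - (A + 1))] when [B = 0]. *)
Lemma discriminant (A B C : R) :
  (forall l m : R, 0 <= l ^+ 2 * A + 2 * l * m * C + m ^+ 2 * B) -> C ^+ 2 <= A * B.
Proof.
move=> H.
have A0 : 0 <= A by have := H 1 0; nra.
have B0 : 0 <= B by have := H 0 1; nra.
have [B0'|] := ltP 0 B.
  have := H B (- C); rewrite (_ : _ + _ = B * (A * B - C ^+ 2)); last by ring.
  by rewrite pmulr_rge0// subr_ge0.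
move=> Bn; have {Bn B0} B0 : B = 0 by apply/eqP; rewrite eq_le Bn B0.
rewrite B0 in H *; have := H C (- (A + 1)).
rewrite (_ : _ + _ = - (A + 2) * C ^+ 2); last by ring.
by rewrite mulr0 mulNr oppr_ge0 pmulr_rle0// ltr_wpDl.
Qed.

(** Pairs of real functions stand for the real and imaginary parts of complex
    ones; the inequality is the sign of the quadratic form
    [(l, m) |-> || l f + m g ||^2]. *)
Lemma cauchy_schwarz f1 f2 g1 g2 : sqint f1 -> sqint f2 -> sqint g1 -> sqint g2 ->
  `|\int[mu]_x (f1 x * g1 x + f2 x * g2 x)| <=
  Num.sqrt (\int[mu]_x (f1 x ^+ 2 + f2 x ^+ 2)) *
  Num.sqrt (\int[mu]_x (g1 x ^+ 2 + g2 x ^+ 2)).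
Proof.
move=> sf1 sf2 sg1 sg2.
have fi : rint (fun x => f1 x ^+ 2 + f2 x ^+ 2) by apply: rintD; [case: sf1|case: sf2].
have gi : rint (fun x => g1 x ^+ 2 + g2 x ^+ 2) by apply: rintD; [case: sg1|case: sg2].
have ci : rint (fun x => f1 x * g1 x + f2 x * g2 x) by apply: rintD; exact: sqint_mul.
rewrite -sqrtrM; last by apply: Rintegral_ge0 => x _; rewrite addr_ge0// sqr_ge0.
rewrite -sqrtr_sqr ler_wsqrtr//; apply: discriminant => l m.
have -> : l ^+ 2 * \int[mu]_x (f1 x ^+ 2 + f2 x ^+ 2) +
  2 * l * m * \int[mu]_x (f1 x * g1 x + f2 x * g2 x) +
  m ^+ 2 * \int[mu]_x (g1 x ^+ 2 + g2 x ^+ 2) =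
  \int[mu]_x ((l * f1 x + m * g1 x) ^+ 2 + (l * f2 x + m * g2 x) ^+ 2).
  rewrite -!RintegralZl//.
  rewrite -RintegralD//; [|exact: rintZ|exact: rintZ].
  rewrite -RintegralD//; [|by apply: rintD; exact: rintZ|exact: rintZ].
  by apply: eq_Rintegral => x _; ring.
by apply: Rintegral_ge0 => x _; rewrite addr_ge0// sqr_ge0.
Qed.

End SquareIntegrable.

Section L2.
Context {R : realType}.
Notation mu := (@lebesgue_measure R).
Implicit Types (f g h x : R -> R[i]).
Notation re f := (fun t => complex.Re (f t)).
Notation im f := (fun t => complex.Im (f t)).
Notation normc := ComplexField.Normc.normc.

(** The square of the L^2 norm. *)
Definition energy f := \int[mu]_t (complex.Re (f t) ^+ 2 + complex.Im (f t) ^+ 2).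

Lemma energy_ge0 f : 0 <= energy f.
Proof. by apply: Rintegral_ge0 => x _; rewrite addr_ge0// sqr_ge0. Qed.

Lemma normcE (z : R[i]) : normc z = Num.sqrt (complex.Re z ^+ 2 + complex.Im z ^+ 2).
Proof. by case: z. Qed.

Lemma normc_ge0 (z : R[i]) : 0 <= normc z.
Proof. by rewrite normcE sqrtr_ge0. Qed.

Lemma normc_sqr (z : R[i]) : normc z ^+ 2 = complex.Re z ^+ 2 + complex.Im z ^+ 2.
Proof. by rewrite normcE sqr_sqrtr// addr_ge0// sqr_ge0. Qed.

Lemma cnorm2_poweR f : cnorm 2%:E f =
  ((\int[mu]_t (complex.Re (f t) ^+ 2 + complex.Im (f t) ^+ 2)%:E) `^ 2^-1)%E.
Proof.
rewrite /cnorm unlock; congr (_ `^ _)%E; apply: eq_integral => t _.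
rewrite /= ger0_norm ?normc_ge0// -normc_sqr.
by rewrite powR_mulrn// normc_ge0.
Qed.

Lemma cnorm2E f : sqint (re f) -> sqint (im f) -> cnorm 2%:E f = (Num.sqrt (energy f))%:E.
Proof.
move=> [_ sr] [_ si]; rewrite cnorm2_poweR rint_EFin; last exact: rintD.
by rewrite poweR_EFin powR12_sqrt// energy_ge0.
Qed.

Lemma isLp2P f : isLp 2%:E f <-> sqint (re f) /\ sqint (im f).
Proof.
split=> [[mr mi foo]|[sr si]]; last first.
  by split; [case: sr|case: si|rewrite cnorm2E// ltry].
have ii : rint (fun t => complex.Re (f t) ^+ 2 + complex.Im (f t) ^+ 2).
  apply/integrableP; split.
    by apply/measurable_EFinP; apply: measurable_funD; exact: measurable_funX.
  rewrite ltey; apply/eqP => /= E.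
  move: foo; rewrite cnorm2_poweR (_ : (\int[_]_t _)%E = +oo%E).
    by rewrite poweRyr ?gt_eqF// invr_gt0.
  rewrite -E; apply: eq_integral => t _ /=.
  by rewrite ger0_norm// addr_ge0// sqr_ge0.
split; (split; first by []); apply: rint_le ii => [|t].
- exact: measurable_funX.
- by rewrite ger0_norm ?sqr_ge0// lerDl sqr_ge0.
- exact: measurable_funX.
- by rewrite ger0_norm ?sqr_ge0// lerDr sqr_ge0.
Qed.

(** Duality in the plane: it turns a bound on the modulus of an integral into
    bounds on real integrals. *)
Lemma normc_leP (z : R[i]) (c : R) : 0 <= c ->
  (forall a b : R, a * complex.Re z + b * complex.Im z <= c * Num.sqrt (a ^+ 2 + b ^+ 2)) ->
  normc z <= c.
Proof.
move=> c0 /(_ (complex.Re z) (complex.Im z)).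
rewrite -!expr2 -normc_sqr sqrtr_sqr ger0_norm ?normc_ge0// expr2.
have [z0|z0] := ltP 0 (normc z); first by rewrite ler_pM2r.
by move=> _; exact: le_trans z0 c0.
Qed.

Lemma ReM (z w : R[i]) : complex.Re (z * w) =
  complex.Re z * complex.Re w - complex.Im z * complex.Im w.
Proof. by case: z w => ? ? []. Qed.

Lemma ImM (z w : R[i]) : complex.Im (z * w) =
  complex.Re z * complex.Im w + complex.Im z * complex.Re w.
Proof. by case: z w => ? ? []. Qed.

Lemma isLp2_subr t h : isLp 2%:E h -> isLp 2%:E (fun s => h (t - s)).
Proof.
move=> /isLp2P[hr hi]; apply/isLp2P.
by split; [exact: (sqint_subr t hr)|exact: (sqint_subr t hi)].
Qed.

Lemma isLp2_mul_rint x h : isLp 2%:E x -> isLp 2%:E h ->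
  rint (fun s => complex.Re (x s * h s)) /\ rint (fun s => complex.Im (x s * h s)).
Proof.
move=> /isLp2P[xr xi] /isLp2P[hr hi]; split.
  under [X in rint X]funext do rewrite ReM.
  by apply: rintB; exact: sqint_mul.
under [X in rint X]funext do rewrite ImM.
by apply: rintD; exact: sqint_mul.
Qed.

Lemma energy_subr t h : isLp 2%:E h -> energy (fun s => h (t - s)) = energy h.
Proof.
move=> /isLp2P[[mr _] [mi _]].
have mE : measurable_fun setT (fun s => complex.Re (h s) ^+ 2 + complex.Im (h s) ^+ 2).
  by apply: measurable_funD; exact: measurable_funX.
exact: (Rint_subr t mE).
Qed.

(** Multiplying by [a - i b] inside the integral rotates [h]; Cauchy-Schwarz
    then gives the bound on each real linear form of the value. *)
Lemma conv_bound x h t : isLp 2%:E x -> isLp 2%:E h ->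
  normc (conv x h t) <= Num.sqrt (energy x) * Num.sqrt (energy h).
Proof.
move=> xL hL; rewrite -(energy_subr t hL).
have {hL} := isLp2_subr t hL; set k := fun s => h (t - s) => kL.
have [iR iI] := isLp2_mul_rint xL kL.
have /isLp2P[xr xi] := xL; have /isLp2P[kr ki] := kL.
apply: normc_leP => [|a b]; first by rewrite mulr_ge0// sqrtr_ge0.
rewrite /conv /cintegral /= -/k.
rewrite -!RintegralZl// -RintegralD//; [|exact: rintZ|exact: rintZ].
have /le_trans : \int[mu]_s (a * complex.Re (x s * k s) + b * complex.Im (x s * k s)) <=
   `|\int[mu]_s (complex.Re (x s) * (a * complex.Re (k s) + b * complex.Im (k s)) +
              complex.Im (x s) * (b * complex.Re (k s) - a * complex.Im (k s)))|.
  apply: le_trans (ler_norm _); rewrite le_eqVlt; apply/orP; left; apply/eqP.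
  by apply: eq_Rintegral => s _; rewrite ReM ImM; ring.
apply; apply: (le_trans (cauchy_schwarz xr xi _ _)).
- by apply: sqintD; exact: sqintZ.
- by apply: sqintB; exact: sqintZ.
rewrite -mulrA ler_wpM2l ?sqrtr_ge0// -sqrtrM ?energy_ge0//.
rewrite ler_wsqrtr// mulrC /energy -RintegralZl//; last by apply: rintD; [case: kr|case: ki].
rewrite le_eqVlt; apply/orP; left; apply/eqP.
by apply: eq_Rintegral => s _; ring.
Qed.

End L2.

(** * Lebesgue points *)

Section LebesguePoints.
Context {R : realType}.
Notation mu := (@lebesgue_measure R).
Implicit Types (f g : R -> R).

Lemma rint_indic (A : set R) : measurable A -> (mu A < +oo)%E -> rint (\1_A : R -> R).
Proof.
move=> mA Aoo; apply/integrableP; split; first exact/measurable_EFinP.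
rewrite (_ : (\int[_]_x _)%E = (\int[mu]_x (\1_A x)%:E)%E).
  by rewrite integral_indic// setIT.
by apply: eq_integral => x _; rewrite /= ger0_norm.
Qed.

Lemma rint_ball (a d : R) : rint (\1_(ball a d) : R -> R).
Proof.
apply: rint_indic; first exact: measurable_ball.
have [d0|d0] := leP 0 d; first by rewrite lebesgue_measure_ball// ltry.
by rewrite (ball0 _ _).2 ?measure0// ltW.
Qed.

Lemma Rint_ball (a d : R) : 0 <= d -> \int[mu]_x (\1_(ball a d) x) = d *+ 2.
Proof.
move=> d0; rewrite /Rintegral integral_indic//; last exact: measurable_ball.
by rewrite setIT; exact: (congr1 fine (lebesgue_measure_ball a d0)).
Qed.

Lemma sqint_locally_integrable f : sqint f -> locally_integrable setT f.
Proof.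
move=> [mf fi]; split => //; first exact: openT.
move=> K _ cK; have mK := compact_measurable cK.
have /integrableP[_] : rint (fun x => f x * \1_K x).
  apply: (@rint_le _ _ (fun x => f x ^+ 2 + \1_K x)).
  - exact: measurable_funM.
  - move=> x; rewrite normrM indicE; case: (_ \in _) => /=; rewrite ?normr1 ?normr0 ?mulr0.
      rewrite mulr1 -[f x ^+ 2]real_normK ?num_real//.
      by have := sqr_ge0 (`|f x| - 1); have := normr_ge0 (f x); nra.
    by rewrite addr0 sqr_ge0.
  - apply: rintD => //; apply: rint_indic => //; exact: compact_finite_measure.
apply: le_lt_trans; rewrite integral_mkcond.
rewrite le_eqVlt; apply/orP; left; apply/eqP; apply: eq_integral => x _ /=.
rewrite patchE indicE; case: (_ \in _) => /=; first by rewrite mulr1.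
by rewrite mulr0 normr0.
Qed.

(** The bound is [e * d] although the ball has length [2 * d], so that the factor
    2 does not reappear in the applications. *)
Lemma lebesgue_pt_small f x (e : R) : sqint f -> lebesgue_pt f x -> 0 < e ->
  \forall d \near 0^'+, \int[mu]_y (`|f y - f x| * \1_(ball x d) y) <= e * d.
Proof.
move=> sf fx e0.
have e2 : 0 < e / 2 by rewrite divr_gt0.
move/fine_cvgP : fx => [fin /cvgrPdist_lt /(_ _ e2) small].
near=> d.
have d0 : 0 < d by near: d; exact: nbhs_right_gt.
have dfin : davg f x d \is a fin_num by near: d.
have : `|0 - fine (davg f x d)| < e / 2 by near: d.
rewrite sub0r normrN ger0_norm; last by rewrite fine_ge0// davg_ge0.
move: dfin; rewrite /davg /iavg (lebesgue_measure_ball x (ltW d0)).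
rewrite inver mulrn_eq0/= gt_eqF//.
rewrite (_ : (\int[_]_(y in _) _)%E =
  (\int[mu]_y (`|f y - f x| * \1_(ball x d) y))%:E); last first.
  rewrite integral_mkcond -rint_EFin; last first.
    have [mf _] := sf.
    have sb : sqint (\1_(ball x d) : R -> R).
      apply: (@rint_bounded_sqint _ _ 1); first exact: rint_ball.
      by move=> y; rewrite indicE; case: (_ \in _); rewrite ?normr1 ?normr0.
    apply: (@rint_le _ _ (fun y => `|f y * \1_(ball x d) y| + `|f x| * \1_(ball x d) y)).
    - apply: measurable_funM => //; last exact: rint_measurable (rint_ball _ _).
      by apply: measurableT_comp => //; exact: measurable_funB.
    - move=> y; rewrite indicE; case: (_ \in _).
        by rewrite !mulr1 normr_id ler_normB.
      by rewrite !mulr0 normr0 addr0.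
    - apply: rintD; last by apply: rintZ; exact: rint_ball.
      by apply: rint_norm; exact: sqint_mul.
  apply: eq_integral => y _ /=; rewrite patchE indicE.
  by case: (_ \in _) => /=; rewrite ?mulr1 ?mulr0.
move=> _; rewrite -EFinM /= ltr_pdivrMl ?mulrn_wgt0//.
move=> /ltW /le_trans; apply; rewrite le_eqVlt; apply/orP; left; apply/eqP.
by rewrite -mulr_natl; field.
Unshelve. all: by end_near. Qed.

Lemma sqint_lebesgue_pt f : sqint f -> {ae mu, forall x, lebesgue_pt f x}.
Proof. by move=> sf; apply: lebesgue_differentiation; exact: sqint_locally_integrable. Qed.

End LebesguePoints.

(** * Tent functions as an approximate identity *)

Section Tent.
Context {R : realType}.
Notation mu := (@lebesgue_measure R).
Implicit Types (f g r : R -> R).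

(** The triangle of height [d] and support [[-d, d]], written as a second
    difference of the absolute value because this is how it arises as a cosine
    transform. *)
Definition tent (d t : R) := (`|t + d| + `|t - d|) / 2 - `|t|.

Lemma tent_ge0 d t : 0 <= tent d t.
Proof.
rewrite subr_ge0 ler_pdivlMr// -[X in `|_| * X]gtr0_norm// -normrM.
have := ler_normD (t + d) (t - d); rewrite (_ : t + d + (t - d) = t * 2)//; ring.
Qed.

Lemma in_ballE (a d t : R) : (t \in (ball a d : set R)) = (`|t - a| < d).
Proof. by apply/idP/idP; rewrite inE /ball /= distrC. Qed.

Lemma tent_le d t a : 0 < d -> tent d (t - a) <= d * \1_(ball a d) t.
Proof.
move=> d0; rewrite indicE in_ballE /tent; set s := t - a.
have [|sd] /= := ltP `|s| d; rewrite ?mulr1 ?mulr0.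
  have := normr_ge0 s.
  have := ler_normD s d; have := ler_normB s d; rewrite (gtr0_norm d0); lra.
have [s0|s0] := leP 0 s.
  by rewrite (ger0_norm s0) in sd *; rewrite !ger0_norm; lra.
by rewrite (ltr0_norm s0) in sd *; rewrite !ler0_norm; lra.
Qed.

Lemma tent_lower d t a : 0 < d -> d / 2 * \1_(ball a (d / 2)) t <= tent d (t - a).
Proof.
move=> d0; rewrite indicE in_ballE.
have [|sd] /= := ltP `|t - a| (d / 2); rewrite ?mulr0 ?tent_ge0// mulr1 /tent.
set s := t - a; rewrite ltr_norml => /andP[s1 s2].
rewrite (@ger0_norm _ (s + d)) ?(@ler0_norm _ (s - d)); try lra.
have [s0|s0] := leP 0 s; [rewrite ger0_norm//|rewrite ltr0_norm//]; lra.
Qed.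

Lemma measurable_tent d a : measurable_fun setT (fun t : R => tent d (t - a)).
Proof.
apply: measurable_funB; last by apply: measurableT_comp => //; exact: measurable_funB.
apply: measurable_funM => //; apply: measurable_funD;
  apply: measurableT_comp => //.
  by apply: measurable_funD => //; exact: measurable_funB.
by apply: measurable_funB => //; exact: measurable_funB.
Qed.

Lemma rint_tent d a : 0 < d -> rint (fun t => tent d (t - a)).
Proof.
move=> d0; apply: (@rint_le _ _ (fun t => d * \1_(ball a d) t)).
- exact: measurable_tent.
- by move=> t; rewrite ger0_norm ?tent_ge0// tent_le.
- by apply: rintZ; exact: rint_ball.
Qed.

Lemma sqint_tent d a : 0 < d -> sqint (fun t => tent d (t - a)).
Proof.
move=> d0; apply: (@rint_bounded_sqint _ _ d); first exact: rint_tent.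
move=> t; rewrite ger0_norm ?tent_ge0//; apply: (le_trans (tent_le _ _ d0)).
rewrite indicE; case: (_ \in _) => /=; rewrite ?mulr1// mulr0 ltW//.
Qed.

Lemma Rint_tent_ge d a : 0 < d -> d ^+ 2 / 2 <= \int[mu]_t tent d (t - a).
Proof.
move=> d0; have d2 : 0 <= d / 2 by rewrite divr_ge0// ltW.
rewrite (_ : d ^+ 2 / 2 = \int[mu]_t (d / 2 * \1_(ball a (d / 2)) t)).
  apply: le_Rintegral => //; [by apply: rintZ; exact: rint_ball|exact: rint_tent|].
  by move=> t _; exact: tent_lower.
rewrite RintegralZl//; last exact: rint_ball.
by rewrite Rint_ball// -mulr_natl; field.
Qed.

(** At a Lebesgue point [a], the tent of width [d] has mass of order [d ^ 2] while
    [r - r a] integrates to [o (d ^ 2)] against it; so a vanishing integral forces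
    [r a = 0]. *)
Lemma tent_separates r : sqint r ->
  (forall a d, 0 < d -> \int[mu]_t (r t * tent d (t - a)) = 0) ->
  {ae mu, forall t, r t = 0}.
Proof.
move=> sr r0; have [mr _] := sr.
apply: filterS (sqint_lebesgue_pt sr) => a ra.
apply/eqP; rewrite -normr_le0; apply/ler_addgt0Pr => e e0; rewrite add0r.
have e2 : 0 < e / 2 by rewrite divr_gt0.
have H := lebesgue_pt_small sr ra e2.
have [d [d0 Hd]] : exists d, 0 < d /\
    \int[mu]_y (`|r y - r a| * \1_(ball a d) y) <= e / 2 * d.
  have : \forall d \near 0^'+, 0 < d /\
      \int[mu]_y (`|r y - r a| * \1_(ball a d) y) <= e / 2 * d.
    by near=> d; split; [near: d; exact: nbhs_right_gt|near: d].
  by move=> /filter_ex.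
have it := rint_tent a d0.
have irt : rint (fun t => r t * tent d (t - a)) by apply: sqint_mul => //; exact: sqint_tent.
have E : r a * \int[mu]_t tent d (t - a) = - \int[mu]_t ((r t - r a) * tent d (t - a)).
  rewrite (_ : \int[mu]_t ((r t - r a) * tent d (t - a)) =
    \int[mu]_t (r t * tent d (t - a) - r a * tent d (t - a))).
    rewrite (@RintegralB _ _ _ mu setT (fun t => r t * _) (fun t => r a * _))//; last exact: rintZ.
    by rewrite r0// sub0r opprK RintegralZl.
  by apply: eq_Rintegral => t _; rewrite mulrBl.
have le1 : `|r a| * (d ^+ 2 / 2) <= `|\int[mu]_t ((r t - r a) * tent d (t - a))|.
  rewrite -[leRHS]normrN -E normrM ler_wpM2l// (le_trans (Rint_tent_ge a d0))//.
  exact: ler_norm.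
have irat : rint (fun t => (r t - r a) * tent d (t - a)).
  under [X in rint X]funext do rewrite mulrBl.
  by apply: rintB => //; exact: rintZ.
have ib : rint (fun t => `|r t - r a| * \1_(ball a d) t).
  apply: (@rint_le _ _ (fun t => `|r t * \1_(ball a d) t| + `|r a * \1_(ball a d) t|)).
  - apply: measurable_funM; last exact: rint_measurable (rint_ball _ _).
    by apply: measurableT_comp => //; exact: measurable_funB.
  - move=> t; rewrite indicE; case: (_ \in _) => /=;
      rewrite ?mulr1 ?mulr0 ?normr_id ?normr0 ?addr0//.
    exact: ler_normB.
  - apply: rintD; apply: rint_norm; last by apply: rintZ; exact: rint_ball.
    apply: sqint_mul => //; apply: (@rint_bounded_sqint _ _ 1); first exact: rint_ball.
    by move=> y; rewrite indicE; case: (_ \in _) => /=; rewrite ?normr1 ?normr0.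
have le2 : `|\int[mu]_t ((r t - r a) * tent d (t - a))| <= d * (e / 2 * d).
  apply: (le_trans (abse_Rint irat)).
  apply: (@le_trans _ _ (\int[mu]_t (d * (`|r t - r a| * \1_(ball a d) t)))).
    apply: le_Rintegral => //; [exact: rint_norm|exact: rintZ|].
    move=> t _; rewrite normrM (ger0_norm (tent_ge0 _ _)) mulrCA ler_wpM2l//.
    exact: tent_le.
  rewrite RintegralZl//.
  by rewrite ler_wpM2l// ltW.
have := le_trans le1 le2.
rewrite (_ : d * (e / 2 * d) = e * (d ^+ 2 / 2)); last by field.
by rewrite ler_pM2r// divr_gt0// exprn_gt0.
Unshelve. all: by end_near. Qed.

End Tent.

(** * The kernel (1 - cos (t w)) / w^2 *)

Section CosineKernel.
Context {R : realType}.
Notation mu := (@lebesgue_measure R).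

Lemma measurable_cos : measurable_fun setT (@cos R).
Proof. by apply: continuous_measurable_fun; exact: continuous_cos. Qed.

Lemma measurable_sin : measurable_fun setT (@sin R).
Proof. by apply: continuous_measurable_fun; exact: continuous_sin. Qed.

Lemma norm_sin_le (x : R) : `|sin x| <= `|x|.
Proof.
wlog x0 : x / 0 <= x.
  have [x0|x0] := leP 0 x; first by apply.
  by move=> /(_ (- x)); rewrite sinN !normrN; apply; rewrite oppr_ge0 ltW.
have cs : {within `[0, x], continuous (@sin R)}.
  by apply: continuous_subspaceT; exact: continuous_sin.
have [c _] := MVT_segment x0 (fun y _ => is_derive_sin y) cs.
rewrite sin0 !subr0 => ->.
by rewrite normrM ler_piMl// cos_max.
Qed.

Lemma cos_quadratic (x : R) : 1 - cos x <= x ^+ 2.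
Proof.
have [y ->] : exists y : R, x = y *+ 2.
  by exists (x / 2); rewrite -[RHS]mulr_natr divfK.
have s2 : sin y ^+ 2 <= y ^+ 2.
  rewrite -[leLHS]real_normK ?num_real// -[leRHS]real_normK ?num_real//.
  by rewrite lerXn2r ?nnegrE// norm_sin_le.
rewrite cos_mulr2n (_ : (y *+ 2) ^+ 2 = 4 * y ^+ 2); last by ring.
by rewrite mulr2n; have := cos2Dsin2 y; have := sqr_ge0 y; lra.
Qed.

(** Since division by 0 gives 0, the value at [w = 0] is 0 and not the limit
    [t ^ 2 / 2]; only a null set is affected, and every pointwise identity below
    still holds there. *)
Definition versinc (t w : R) : R := (1 - cos (w * t)) / w ^+ 2.

Lemma versinc_ge0 t w : 0 <= versinc t w.
Proof. by rewrite divr_ge0 ?sqr_ge0// subr_ge0 cos_le1. Qed.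

Lemma measurable_invsqr : measurable_fun setT (fun w : R => (w ^+ 2)^-1).
Proof.
rewrite (_ : (fun w => _) = (fun w : R => (w ^+ 2) `^ (- 1))).
  by apply: (measurableT_comp (measurable_powR _)); exact: exprn_measurable.
by apply/funext => w; rewrite powR_inv1// sqr_ge0.
Qed.

Lemma measurable_versinc t : measurable_fun setT (versinc t).
Proof.
apply: measurable_funM; last exact: measurable_invsqr.
apply: measurable_funB => //; apply: (measurableT_comp measurable_cos).
exact: measurable_funM.
Qed.

Lemma versincN t w : versinc t (- w) = versinc t w.
Proof. by rewrite /versinc mulNr cosN sqrrN. Qed.

Lemma versinc_le t w : versinc t w <= t ^+ 2.
Proof.
have [->|w0] := eqVneq w 0; first by rewrite /versinc expr0n invr0 mulr0 sqr_ge0.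
by rewrite ler_pdivrMr ?exprn_even_gt0// -exprMn mulrC cos_quadratic.
Qed.

Lemma rint_oneDsqrV : rint (fun x : R => (oneDsqr x)^-1).
Proof.
have mo : measurable_fun setT (fun x : R => (oneDsqr x)^-1).
  by apply: continuous_measurable_fun; exact: continuous_oneDsqrV.
have half : rint (fun x : R => (oneDsqr x)^-1 * \1_(`[0, +oo[) x).
  apply/integrableP; split.
    by apply/measurable_EFinP; apply: measurable_funM.
  rewrite (_ : (\int[_]_x _)%E = (\int[mu]_(x in `[0%R, +oo[) (oneDsqr x)^-1%:E)%E).
    by rewrite integral0y_oneDsqr ltry.
  rewrite [RHS]integral_mkcond; apply: eq_integral => x _ /=.
  rewrite patchE indicE; case: (_ \in _) => /=; last by rewrite mulr0 normr0.
  by rewrite mulr1 ger0_norm// invr_ge0.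
apply: rint_le (rintD half (rint_reflect half)) => // x.
have o0 : 0 <= (oneDsqr x)^-1 by rewrite invr_ge0.
rewrite ger0_norm// /oneDsqr sqrrN -/(oneDsqr x) -mulrDr ler_peMr// !indicE.
rewrite !mem_setE !in_itv /= !andbT oppr_ge0.
by case: (leP 0 x) => [|/ltW ->]; rewrite ?lerDl ?lerDr ler0n.
Qed.

(** The bounds by [t ^ 2] near 0 and by [2 / w ^ 2] at infinity are combined into
    a multiple of [1 / (1 + w ^ 2)]. *)
Lemma rint_versinc t : rint (versinc t).
Proof.
apply: rint_le (rintZ (t ^+ 2 + 2) rint_oneDsqrV) => [|w].
  exact: measurable_versinc.
rewrite ger0_norm ?versinc_ge0// ler_pdivlMr ?(lt_le_trans ltr01)//.
rewrite /oneDsqr mulrDr mulr1 lerD ?versinc_le//.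
have [->|w0] := eqVneq w 0; first by rewrite expr0n mulr0.
rewrite divfK ?sqrf_eq0//.
by have := cos_geN1 (w * t); lra.
Qed.

Lemma sqint_versinc t : sqint (versinc t).
Proof.
apply: (@rint_bounded_sqint _ _ (t ^+ 2)); first exact: rint_versinc.
by move=> w; rewrite ger0_norm ?versinc_ge0// versinc_le.
Qed.

(** The proportionality constant of [Rint_versinc]; its value is pi. *)
Definition versinc_mass := \int[mu]_w versinc 1 w.

(** The substitution of [|t| w] for [w]: the integrand is homogeneous. *)
Lemma Rint_versinc t : \int[mu]_w versinc t w = versinc_mass * `|t|.
Proof.
have [->|t0] := eqVneq t 0.
  by rewrite normr0 mulr0; apply: Rint_eq0 => w; rewrite /versinc mulr0 cos0 subrr mul0r.
have nt0 : 0 < `|t| by rewrite normr_gt0.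
have nt0' : `|t| != 0 by rewrite gt_eqF.
have scale : (\int[mu]_w (versinc 1 w)%:E =
    `|t|%:E * \int[mu]_w (versinc 1 (`|t| * w + 0))%:E)%E.
  apply: (@ge0_integral_affine R `|t| 0 (EFin \o versinc 1)) => //.
    by apply/measurable_EFinP; exact: measurable_versinc.
  by move=> w; rewrite lee_fin versinc_ge0.
have pointwise w : versinc 1 (`|t| * w + 0) = (`|t| ^+ 2)^-1 * versinc t w.
  rewrite addr0 /versinc mulr1 exprMn invfM mulrA mulrCA mulrA; congr (_ * _ * _).
  congr (1 - _); have [tt|tt] := leP 0 t.
    by rewrite (ger0_norm tt) mulrC.
  by rewrite (ltr0_norm tt) mulNr cosN mulrC.
move: scale; under [X in (_ * X)%E]eq_integral do rewrite pointwise.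
rewrite !rint_EFin; [|by apply: rintZ; exact: rint_versinc|exact: rint_versinc].
rewrite RintegralZl//; last exact: rint_versinc.
rewrite -/versinc_mass => -[] ->.
by rewrite expr2 invfM; field.
Qed.

(** On the interval [(1, 2)] the integrand is at least [(1 - cos 1) / 4]. *)
Lemma versinc_mass_gt0 : 0 < versinc_mass.
Proof.
have c1 : cos 1 < 1 :> R.
  rewrite -[ltRHS]cos0 ltr_cos ?ltr01// in_itv/= ?lexx ?pi_ge0// ler01.
  by rewrite (le_trans _ (pi_ge2 R))// ler1n.
have d0 : 0 < (1 - cos 1) / 4 :> R by rewrite divr_gt0// subr_gt0.
apply: (lt_le_trans d0).
rewrite (_ : _ / 4 = \int[mu]_w ((1 - cos 1) / 4 * \1_(ball (3 / 2 : R) (1 / 2)) w)); last first.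
  rewrite RintegralZl//; last exact: rint_ball.
  by rewrite Rint_ball; [rewrite -mulr_natl; field|lra].
apply: le_Rintegral => //; first by apply: rintZ; exact: rint_ball.
  exact: rint_versinc.
move=> w _; rewrite indicE in_ballE.
have [|] := ltP `|w - 3 / 2| (1 / 2); last by rewrite mulr0 versinc_ge0.
rewrite ltr_norml /= mulr1 => /andP[w1 w2].
have w0 : 0 < w by lra.
rewrite /versinc mulr1 ler_pdivlMr ?exprn_gt0//.
have cw : cos w <= cos 1.
  by rewrite ltW// ltr_cos ?in_itv/=; have := pi_ge2 R; lra.
have w4 : w ^+ 2 <= 4 by nra.
by have := ler_wpM2l (ltW d0) w4; lra.
Qed.

(** Modulating by [cos (w t)] is a second difference in the parameter; after
    integration the absolute values of [Rint_versinc] assemble into a tent. *)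
Lemma versinc_cos d w t : versinc d w * cos (w * t) =
  2^-1 * (versinc (t + d) w + versinc (t - d) w) - versinc t w.
Proof.
rewrite /versinc !mulrDr mulrN cosB cosD.
have [->|w0] := eqVneq w 0; first by rewrite expr0n /= invr0 !(mulr0, mul0r, addr0, subrr).
by field; rewrite w0.
Qed.

Lemma Rint_odd (f : R -> R) : rint f ->
  (forall x, f (- x) = - f x) -> \int[mu]_x f x = 0.
Proof.
move=> fi fN; have := Rint_reflect (rint_measurable fi).
under eq_Rintegral do rewrite fN -mulN1r.
by rewrite RintegralZl// mulN1r => E; lra.
Qed.

End CosineKernel.

(** * Hermitian symmetry from a real Fourier transform *)

Section FourierSymmetry.
Context {R : realType}.
Notation mu := (@lebesgue_measure R).
Implicit Types (p q f g : R -> R).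

Lemma tentN d t : tent d (- t) = tent d t :> R.
Proof.
rewrite /tent normrN -(normrN (- t + d)) -(normrN (- t - d)) !opprD !opprK.
by rewrite [_ + `|t + d|]addrC.
Qed.

Lemma Rint_versinc_cos d t : \int[mu]_w (versinc d w * cos (w * t)) =
  versinc_mass * tent d t.
Proof.
under eq_Rintegral do rewrite versinc_cos.
have v u := @rint_versinc R u.
rewrite RintegralB//; [|exact: (rintZ _ (rintD (v _) (v _)))|exact: v].
rewrite RintegralZl//; last exact: (rintD (v _) (v _)).
rewrite RintegralD//; [|exact: v|exact: v].
by rewrite !Rint_versinc /tent; field.
Qed.

Lemma measurable_cosM (t : R) : measurable_fun setT (fun w : R => cos (w * t)).
Proof. by apply: (measurableT_comp measurable_cos); exact: measurable_funM. Qed.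

Lemma measurable_sinM (t : R) : measurable_fun setT (fun w : R => sin (w * t)).
Proof. by apply: (measurableT_comp measurable_sin); exact: measurable_funM. Qed.

Lemma norm_mul_le1 (x y : R) : `|x| <= 1 -> `|y| <= 1 -> `|x * y| <= 1.
Proof. by move=> x1 y1; rewrite normrM -[1]mulr1 ler_pM. Qed.

Lemma sin_max (x : R) : `|sin x| <= 1.
Proof. by rewrite ler_norml sin_geN1 sin_le1. Qed.

Lemma Rint_versinc_coscos d a t :
  \int[mu]_w (versinc d w * (cos (w * a) * cos (w * t))) =
  versinc_mass / 2 * (tent d (t - a) + tent d (t + a)).
Proof.
transitivity (\int[mu]_w (2^-1 * (versinc d w * cos (w * (t - a)) +
                                  versinc d w * cos (w * (t + a))))).
  by apply: eq_Rintegral => w _; rewrite (mulrBr w) (mulrDr w) cosB cosD; field.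
have v u : rint (fun w => versinc d w * cos (w * u)).
  by apply: rintM_bounded; [exact: rint_versinc|exact: measurable_cosM|move=> x; exact: cos_max].
rewrite RintegralZl//; last exact: (rintD (v _) (v _)).
by rewrite RintegralD//; [rewrite !Rint_versinc_cos; field|exact: v|exact: v].
Qed.

Lemma Rint_versinc_sinsin d a t :
  \int[mu]_w (versinc d w * (sin (w * a) * sin (w * t))) =
  versinc_mass / 2 * (tent d (t - a) - tent d (t + a)).
Proof.
transitivity (\int[mu]_w (2^-1 * (versinc d w * cos (w * (t - a)) -
                                  versinc d w * cos (w * (t + a))))).
  by apply: eq_Rintegral => w _; rewrite (mulrBr w) (mulrDr w) cosB cosD; field.
have v u : rint (fun w => versinc d w * cos (w * u)).
  by apply: rintM_bounded; [exact: rint_versinc|exact: measurable_cosM|move=> x; exact: cos_max].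
rewrite RintegralZl//; last exact: (rintB (v _) (v _)).
by rewrite RintegralB//; [rewrite !Rint_versinc_cos; field|exact: v|exact: v].
Qed.

Lemma Rint_versinc_cossin d a t :
  \int[mu]_w (versinc d w * (cos (w * a) * sin (w * t))) = 0.
Proof.
apply: Rint_odd => [|w]; last by rewrite versincN !mulNr cosN sinN !mulrN.
apply: rintM_bounded; first exact: rint_versinc.
  by apply: measurable_funM; [exact: measurable_cosM|exact: measurable_sinM].
by move=> w; apply: norm_mul_le1; [exact: cos_max|exact: sin_max].
Qed.

(** Up to normalization, the imaginary part at [w] of the Fourier integral of
    [p + i q] over [[-n, n]]. *)
Definition im_fourier p q (n w : R) : R :=
  \int[mu]_t ((q t * cos (w * t) - p t * sin (w * t)) * \1_(`[- n, n]) t).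

Lemma rint_itv f (n : R) : sqint f -> rint (fun t => f t * \1_(`[- n, n]) t).
Proof.
move=> sf; apply: sqint_mul => //; apply: (@rint_bounded_sqint _ _ 1).
  apply: rint_indic => //; rewrite lebesgue_measure_itv/=.
  by case: ifP => _; rewrite ?ltry// -EFinB ltry.
by move=> x; rewrite indicE; case: (_ \in _); rewrite /= ?normr1 ?normr0.
Qed.

Lemma measurable_prod_trig (c s : R -> R) a : measurable_fun setT c ->
  measurable_fun setT s ->
  measurable_fun setT (fun z : R * R => c (z.1 * a) * s (z.1 * z.2)).
Proof.
move=> mc ms; apply: measurable_funM.
  apply: (measurableT_comp mc); apply: measurable_funM => //; exact: measurable_fst.
apply: (measurableT_comp ms).
by apply: measurable_funM; [exact: measurable_fst|exact: measurable_snd].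
Qed.

Lemma im_fourierE p q n w : sqint p -> sqint q -> im_fourier p q n w =
  \int[mu]_t (q t * \1_(`[- n, n]) t * cos (w * t)) -
  \int[mu]_t (p t * \1_(`[- n, n]) t * sin (w * t)).
Proof.
move=> sp sq; rewrite -RintegralB//.
- by apply: eq_Rintegral => t _; ring.
- apply: rintM_bounded; [exact: rint_itv| |move=> x; exact: cos_max].
  by under eq_fun do rewrite mulrC; exact: measurable_cosM.
- apply: rintM_bounded; [exact: rint_itv| |move=> x; exact: sin_max].
  by under eq_fun do rewrite mulrC; exact: measurable_sinM.
Qed.

Lemma Rint_trig_pull f (n a w : R) (c s : R -> R) : measurable_fun setT c ->
  (forall x, `|c x| <= 1) -> sqint f -> measurable_fun setT s ->
  (forall x, `|s x| <= 1) ->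
  \int[mu]_t (f t * \1_(`[- n, n]) t * (c (w * a) * s (w * t))) =
  c (w * a) * \int[mu]_t (f t * \1_(`[- n, n]) t * s (w * t)).
Proof.
move=> mc c1 sf ms s1; rewrite -RintegralZl; [|exact: measurableT|].
  by apply: eq_Rintegral => t _; rewrite mulrCA.
apply: rintM_bounded; [exact: rint_itv| |by move=> x; exact: s1].
by apply: (measurableT_comp ms); exact: measurable_funM.
Qed.

(** Taking [c = cos] keeps only [q] and taking [c = sin] keeps only [p], because
    the product of a cosine and a sine is odd in [w]. *)
Lemma im_fourier_pairing p q n d a (c : R -> R) : sqint p -> sqint q ->
  measurable_fun setT c -> (forall x, `|c x| <= 1) ->
  \int[mu]_w (versinc d w * c (w * a) * im_fourier p q n w) =
  \int[mu]_t (q t * \1_(`[- n, n]) t *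
     \int[mu]_w (versinc d w * (c (w * a) * cos (w * t)))) -
  \int[mu]_t (p t * \1_(`[- n, n]) t *
     \int[mu]_w (versinc d w * (c (w * a) * sin (w * t)))).
Proof.
move=> sp sq mc c1.
have iv := @rint_versinc R d.
pose Kc (z : R * R) := c (z.1 * a) * cos (z.1 * z.2).
pose Ks (z : R * R) := c (z.1 * a) * sin (z.1 * z.2).
have [ic Ec] := @Rint_swap R _ _ Kc 1 iv (rint_itv n sq)
  (measurable_prod_trig a mc measurable_cos)
  (fun z => norm_mul_le1 (c1 _) (cos_max _)).
have [is_ Es] := @Rint_swap R _ _ Ks 1 iv (rint_itv n sp)
  (measurable_prod_trig a mc measurable_sin)
  (fun z => norm_mul_le1 (c1 _) (sin_max _)).
rewrite -[X in _ = X - _]Ec -[X in _ = _ - X]Es.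
rewrite -RintegralB; [|exact: measurableT|exact: ic|exact: is_].
clear ic is_ Ec Es.
apply: eq_Rintegral => w _; rewrite im_fourierE//.
rewrite (Rint_trig_pull n a w mc c1 sq measurable_cos (@cos_max R)).
rewrite (Rint_trig_pull n a w mc c1 sp measurable_sin sin_max).
by rewrite !mulrBr !mulrA.
Qed.

Lemma eventually_cst_cvg0 (u : nat -> R) c : u @ \oo --> (0 : R) ->
  (\forall n \near \oo, u n = c) -> c = 0.
Proof.
move=> u0 uc; apply: (@cvg_unique _ (@Rhausdorff R) (u @ \oo)) => //.
by apply: cvg_near_cst; near=> n; near: n.
Unshelve. all: by end_near. Qed.

Lemma tent_itv (n d a t : R) : 0 < d -> `|a| + d <= n ->
  \1_(`[- n, n]) t * tent d (t - a) = tent d (t - a).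
Proof.
move=> d0 dn; rewrite indicE.
have [ab|ba] := ltP `|t - a| d.
  rewrite mem_set ?mul1r//= in_itv /= -ler_norml.
  by have := ler_normD (t - a) a; rewrite subrK; lra.
suff -> : tent d (t - a) = 0 by rewrite mulr0.
apply/eqP; rewrite eq_le tent_ge0 andbT; apply: (le_trans (tent_le _ _ d0)).
by rewrite indicE in_ballE ltNge ba mulr0.
Qed.

Lemma tent_itv_sum (n d a t s : R) : 0 < d -> `|a| + d <= n ->
  \1_(`[- n, n]) t * (tent d (t - a) + s * tent d (t + a)) =
  tent d (t - a) + s * tent d (t + a).
Proof.
move=> d0 dn; rewrite mulrDr mulrCA tent_itv//.
by have := @tent_itv n d (- a) t d0; rewrite opprK normrN => ->.
Qed.

Lemma Rint_tent_reflect f d a : sqint f -> 0 < d ->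
  \int[mu]_t (f t * tent d (t + a)) = \int[mu]_t (f (- t) * tent d (t - a)).
Proof.
move=> sf d0.
have m : measurable_fun setT (fun t => f t * tent d (t + a)).
  have [mf _] := sf; apply: measurable_funM => //.
  by have := measurable_tent d (- a); under eq_fun do rewrite opprK.
rewrite -(Rint_reflect m); apply: eq_Rintegral => t _.
by rewrite -[in LHS](tentN d) opprD opprK.
Qed.

(** The test function is [versinc d w] times [cos (a w)], respectively
    [sin (a w)]. Its pairing with the truncated transforms tends to 0, and it is
    constant as soon as [n >= |a| + d], because the tents have compact support. So
    [q t + q (- t)] and [p t - p (- t)] are orthogonal to all tents. *)
Lemma im_fourier_symmetry p q : sqint p -> sqint q ->
  (forall f, sqint f ->
    (fun n : nat => \int[mu]_w (f w * im_fourier p q n%:R w)) @ \oo --> (0 : R)) ->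
  {ae mu, forall t, q t + q (- t) = 0} /\ {ae mu, forall t, p t - p (- t) = 0}.
Proof.
move=> sp sq H.
have C0 : versinc_mass != 0 :> R by rewrite gt_eqF// versinc_mass_gt0.
have C2 : versinc_mass / 2 != 0 :> R by rewrite mulf_neq0.
have test (c : R -> R) a d : measurable_fun setT c -> (forall x, `|c x| <= 1) ->
    sqint (fun w => versinc d w * c (w * a)).
  move=> mc c1; apply: sqint_le (sqint_versinc d) => [|w].
    apply: measurable_funM; first exact: measurable_versinc.
    by apply: (measurableT_comp mc); exact: measurable_funM.
  by rewrite normrM ler_piMr.
have ti (r : R -> R) d a : sqint r -> 0 < d -> rint (fun t => r t * tent d (t - a)).
  by move=> sr d0; apply: sqint_mul => //; exact: sqint_tent.
have ti' (r : R -> R) d a : sqint r -> 0 < d -> rint (fun t => r t * tent d (t + a)).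
  by move=> sr d0; rewrite -[a]opprK; exact: ti.
have tsum (r : R -> R) s d a : sqint r -> 0 < d ->
    rint (fun t => r t * (tent d (t - a) + s * tent d (t + a))).
  move=> sr d0; under [X in rint X]funext do rewrite mulrDr [_ * (s * _)]mulrCA.
  by apply: rintD; [exact: ti|apply: rintZ; exact: ti'].
split; apply: tent_separates.
- by apply: sqintD => //; exact: sqint_reflect.
- move=> a d d0.
  have E : versinc_mass / 2 * \int[mu]_t (q t * (tent d (t - a) + 1 * tent d (t + a))) = 0.
    apply: (eventually_cst_cvg0 (H _ (test cos a d measurable_cos (@cos_max R)))).
    near=> n; rewrite im_fourier_pairing//; [|exact: measurable_cos|exact: cos_max].
    rewrite [X in _ - X = _](_ : _ = 0) ?subr0; last first.
      apply: Rint_eq0 => t.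
      by rewrite Rint_versinc_cossin mulr0.
    rewrite -RintegralZl//; last exact: tsum.
    apply: eq_Rintegral => t _; rewrite Rint_versinc_coscos -mulrA mulrCA.
    rewrite -[in RHS](@tent_itv_sum n%:R)// ?mul1r; first by ring.
    by near: n; exact: nbhs_infty_ger.
  move/eqP: E; rewrite mulf_eq0 (negbTE C2) /= => /eqP E.
  rewrite -[RHS]E.
  under [RHS]eq_Rintegral do rewrite mul1r mulrDr.
  under [LHS]eq_Rintegral do rewrite mulrDl.
  rewrite !RintegralD//; [|exact: ti|exact: ti'|exact: ti|by apply: ti => //; exact: sqint_reflect].
  by rewrite -Rint_tent_reflect.
- by apply: sqintB => //; exact: sqint_reflect.
- move=> a d d0.
  have E : versinc_mass / 2 * \int[mu]_t (p t * (tent d (t - a) + - 1 * tent d (t + a))) = 0.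
    apply/eqP; rewrite -oppr_eq0; apply/eqP.
    apply: (eventually_cst_cvg0 (H _ (test sin a d measurable_sin sin_max))).
    near=> n; rewrite im_fourier_pairing//; [|exact: measurable_sin|exact: sin_max].
    rewrite [X in X - _ = _](_ : _ = 0) ?sub0r; last first.
      apply: Rint_eq0 => t.
      rewrite (_ : \int[mu]_w _ = 0) ?mulr0// -[RHS](Rint_versinc_cossin d t a).
      by apply: eq_Rintegral => w _; rewrite [sin _ * _]mulrC.
    congr (- _).
    rewrite -RintegralZl//; last exact: tsum.
    apply: eq_Rintegral => t _; rewrite Rint_versinc_sinsin -mulrA mulrCA.
    rewrite -[in RHS](@tent_itv_sum n%:R)// ?mulN1r; first by ring.
    by near: n; exact: nbhs_infty_ger.
  move/eqP: E; rewrite mulf_eq0 (negbTE C2) /= => /eqP E.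
  rewrite -[RHS]E.
  under [RHS]eq_Rintegral do rewrite mulN1r mulrBr.
  under [LHS]eq_Rintegral do rewrite mulrBl.
  rewrite !RintegralB//; [|exact: ti|exact: ti'|exact: ti|by apply: ti => //; exact: sqint_reflect].
  by rewrite -Rint_tent_reflect.
Unshelve. all: by end_near. Qed.

End FourierSymmetry.

Section FourierSymmetryC.
Context {R : realType}.
Notation mu := (@lebesgue_measure R).
Implicit Types (h : R -> R[i]).
Notation re f := (fun t => complex.Re (f t)).
Notation im f := (fun t => complex.Im (f t)).

Notation c := ((Num.sqrt (2 * pi))^-1 : R).

Lemma Rint_indic (A : set R) (f : R -> R) :
  \int[mu]_(t in A) f t = \int[mu]_t (f t * \1_A t).
Proof.
rewrite Rintegral_mkcond; apply: eq_Rintegral => t _.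
by rewrite patchE indicE; case: (_ \in _); rewrite /= ?mulr1 ?mulr0.
Qed.

Lemma truncated_fourier_Im n h w : complex.Im (truncated_fourier n h w) =
  c * im_fourier (re h) (im h) n w.
Proof.
rewrite /truncated_fourier ImM /= mul0r addr0; congr (_ * _).
rewrite Rint_indic; apply: eq_Rintegral => t _; rewrite ImM /=.
by congr (_ * _); ring.
Qed.

Lemma truncated_fourier_Re n h w : complex.Re (truncated_fourier n h w) =
  c * \int[mu]_t ((complex.Re (h t) * cos (w * t) +
                   complex.Im (h t) * sin (w * t)) * \1_(`[- n, n]) t).
Proof.
rewrite /truncated_fourier ReM /= mul0r subr0; congr (_ * _).
rewrite Rint_indic; apply: eq_Rintegral => t _; rewrite ReM /=.
by congr (_ * _); ring.
Qed.

Lemma measurable_truncated_fourier n h : isLp 2%:E h ->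
  measurable_fun setT (re (truncated_fourier n h)) /\
  measurable_fun setT (im (truncated_fourier n h)).
Proof.
move=> /isLp2P[[mr _] [mi _]].
have m2 (f : R -> R) : measurable_fun setT f ->
    measurable_fun setT (fun z : R * R => f z.2).
  by move=> mf; apply: (measurableT_comp mf); exact: measurable_snd.
have mcs (f : R -> R) : measurable_fun setT f ->
    measurable_fun setT (fun z : R * R => f (z.1 * z.2)).
  move=> mf; apply: (measurableT_comp mf).
  by apply: measurable_funM; [exact: measurable_fst|exact: measurable_snd].
have m1 : measurable_fun setT (\1_(`[- n, n]) : R -> R) by [].
split.
  under eq_fun do rewrite truncated_fourier_Re.
  apply: measurable_funM => //.
  apply: (@measurable_Rint_param _ (fun z : R * R =>
    (complex.Re (h z.2) * cos (z.1 * z.2) +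
     complex.Im (h z.2) * sin (z.1 * z.2)) * \1_(`[- n, n]) z.2)).
  apply: measurable_funM; last exact: m2 m1.
  apply: measurable_funD; (apply: measurable_funM; [exact: (m2 (fun t => _ (h t)))|]).
    exact: mcs measurable_cos.
  exact: mcs measurable_sin.
under eq_fun do rewrite truncated_fourier_Im.
apply: measurable_funM => //.
apply: (@measurable_Rint_param _ (fun z : R * R =>
    (complex.Im (h z.2) * cos (z.1 * z.2) -
     complex.Re (h z.2) * sin (z.1 * z.2)) * \1_(`[- n, n]) z.2)).
apply: measurable_funM; last exact: m2 m1.
apply: measurable_funB; (apply: measurable_funM; [exact: (m2 (fun t => _ (h t)))|]).
  exact: mcs measurable_cos.
exact: mcs measurable_sin.
Qed.

(** As [H] is real, the imaginary part of the truncated transform is bounded by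
    the error of the truncation, which tends to 0 in L^2; by Cauchy-Schwarz this
    gives the hypothesis of [im_fourier_symmetry]. *)
Lemma fourier_real_symmetry h H : isLp 2%:E h -> is_fourier h H ->
  {ae mu, forall w, complex.Im (H w) = 0} ->
  {ae mu, forall t, complex.Re (h (- t)) = complex.Re (h t) /\
                    complex.Im (h (- t)) = - complex.Im (h t)}.
Proof.
move=> hL [HL /fine_cvgP[finD cvgD]] H0.
have /isLp2P[sr si] := hL.
have c0 : 0 < c by rewrite invr_gt0 sqrtr_gt0 mulr_gt0// pi_gt0.
pose D (n : nat) w := H w - truncated_fourier n%:R h w.
have pairing f : sqint f ->
    (fun n : nat => \int[mu]_w (f w * im_fourier (re h) (im h) n%:R w)) @ \oo --> (0 : R).
  move=> sf.
  pose A := Num.sqrt (\int[mu]_w (0 ^+ 2 + f w ^+ 2)).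
  have bound : \forall n \near \oo,
      `|\int[mu]_w (f w * im_fourier (re h) (im h) n%:R w)| <=
      c^-1 * A * fine (cnorm 2%:E (D n)).
    near=> n.
    have Dfin : cnorm 2%:E (D n) \is a fin_num by near: n.
    have [mtr mti] := measurable_truncated_fourier n%:R hL.
    have [mHr mHi _] := HL.
    have DE (t : R) :
        complex.Re (D n t) =
          complex.Re (H t) - complex.Re (truncated_fourier n%:R h t) /\
        complex.Im (D n t) =
          complex.Im (H t) - complex.Im (truncated_fourier n%:R h t).
      by rewrite /D; case: (H t) => ? ?; case: (truncated_fourier _ _ _).
    have DL : isLp 2%:E (D n).
      split.
      - by under eq_fun do rewrite (DE _).1; exact: measurable_funB.
      - by under eq_fun do rewrite (DE _).2; exact: measurable_funB.
      - by rewrite -ge0_fin_numE// /cnorm Lnorm_ge0.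
    have /isLp2P[sDr sDi] := DL.
    rewrite cnorm2E//=.
    have s0 : sqint (fun=> 0 : R).
      by have := sqintZ 0 sf; congr sqint; apply/funext => x; rewrite mul0r.
    have := cauchy_schwarz s0 sf sDr sDi.
    rewrite -/A -/(energy _) => CS.
    rewrite -mulrA ler_pdivlMl//; apply: le_trans CS.
    rewrite -[X in X * _]gtr0_norm// -normrM -normrN le_eqVlt.
    apply/orP; left; apply/eqP; congr (`|_|).
    have [mf _] := sf.
    have mi : measurable_fun setT (im_fourier (re h) (im h) n%:R).
      rewrite (_ : im_fourier _ _ _ = (fun w => c^-1 * complex.Im (truncated_fourier n%:R h w))).
        exact: measurable_funM.
      by apply/funext => w; rewrite truncated_fourier_Im mulKf// gt_eqF.
    have step w : complex.Im (H w) = 0 ->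
        - c^-1 * (f w * complex.Im (D n w)) = f w * im_fourier (re h) (im h) n%:R w.
      move=> Hw; rewrite (DE w).2 Hw truncated_fourier_Im sub0r mulrN mulrNN.
      by rewrite mulrCA mulKf// gt_eqF.
    have ifD : rint (fun w => f w * complex.Im (D n w)) by exact: sqint_mul.
    have ae_step : {ae mu, forall w, - c^-1 * (f w * complex.Im (D n w)) =
        f w * im_fourier (re h) (im h) n%:R w}.
      by apply: filterS H0 => w; exact: step.
    have mfim : measurable_fun setT (fun w => f w * im_fourier (re h) (im h) n%:R w).
      exact: measurable_funM.
    rewrite -(ae_eq_Rint _ mfim ae_step); last first.
      by apply: rint_measurable; exact: rintZ.
    rewrite RintegralZl// mulNr mulrN opprK mulVKf ?gt_eqF//.
    by apply: eq_Rintegral => w _; rewrite mul0r add0r.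
  have K0 : 0 < c^-1 * A + 1.
    by rewrite ltr_wpDl// mulr_ge0 ?sqrtr_ge0// invr_ge0 ltW.
  apply/cvgr0Pnorm_le => e e0.
  have Ke : 0 < (c^-1 * A + 1)^-1 * e by rewrite mulr_gt0// invr_gt0.
  have small : \forall n \near \oo,
      `|fine (cnorm 2%:E (D n))| <= (c^-1 * A + 1)^-1 * e.
    by move/cvgr0Pnorm_le : cvgD => /(_ _ Ke).
  apply: filterS2 bound small => n bn sn; apply: (le_trans bn).
  apply: (@le_trans _ _ ((c^-1 * A + 1) * fine (cnorm 2%:E (D n)))).
    by rewrite ler_wpM2r ?lerDl// fine_ge0// Lnorm_ge0.
  by rewrite -ler_pdivlMl//; exact: le_trans (ler_norm _) sn.
have [odd even] := im_fourier_symmetry sr si pairing.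
apply: filterS2 odd even => t o e; split; last by rewrite -[RHS]addr0 -o addKr.
by apply/esym/eqP; rewrite -subr_eq0 e.
Unshelve. all: by end_near. Qed.

End FourierSymmetryC.

(** * Means over shrinking balls *)

Section Averaging.
Context {R : realType}.
Notation mu := (@lebesgue_measure R).
Implicit Types (b f g k : R -> R).

Lemma Rint_dominated (f_ : nat -> R -> R) f g :
  (forall n, measurable_fun setT (f_ n)) -> measurable_fun setT f ->
  {ae mu, forall x, f_ ^~ x @ \oo --> f x} -> rint g ->
  (forall n x, `|f_ n x| <= g x) ->
  (fun n => \int[mu]_x f_ n x) @ \oo --> \int[mu]_x f x.
Proof.
move=> mf_ mf f_f gi fg.
have mE n : measurable_fun setT (fun x => (f_ n x)%:E) by exact/measurable_EFinP.
have mfE : measurable_fun setT (fun x => (f x)%:E) by exact/measurable_EFinP.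
have cE : {ae mu, forall x, setT x -> (fun n => (f_ n x)%:E) @ \oo --> (f x)%:E}.
  by apply: filterS f_f => x fx _; apply: cvg_EFin => //; exact: nearW.
have bE : {ae mu, forall x n, setT x -> (`|(f_ n x)%:E| <= (g x)%:E)%E}.
  by apply: aeW => x n _; rewrite /= lee_fin.
have [] := dominated_convergence (mu := mu) measurableT mE mfE cE gi bE.
move=> fi _ cv; apply: fine_cvg; move: cv.
by rewrite -rint_EFin//.
Qed.

Lemma in_ball0 (d t : R) : \1_(ball (0 : R) d) t = (`|t| < d)%R%:R :> R.
Proof. by rewrite indicE in_ballE subr0. Qed.

Lemma measurable_subz b : measurable_fun setT b ->
  measurable_fun setT (fun z : R * R => b (z.2 - z.1)).
Proof.
move=> mb; apply: (measurableT_comp mb).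
by apply: measurable_funB; [exact: measurable_snd|exact: measurable_fst].
Qed.

Definition mean b (d s : R) :=
  (d *+ 2)^-1 * \int[mu]_t (\1_(ball (0 : R) d) t * b (s - t)).

Lemma rint_ball_bounded b d s M : measurable_fun setT b -> (forall x, `|b x| <= M) ->
  rint (fun t => \1_(ball (0 : R) d) t * b (s - t)).
Proof.
move=> mb bM; apply: (@rintM_bounded _ _ _ M) => //; first exact: rint_ball.
by apply: (measurableT_comp mb); exact: measurable_funB.
Qed.

(** The substitution of [s - t] for [t] centres the ball at [s]. *)
Lemma mean_dist b d s M : 0 < d -> measurable_fun setT b -> (forall x, `|b x| <= M) ->
  `|mean b d s - b s| <= (d *+ 2)^-1 * \int[mu]_y (`|b y - b s| * \1_(ball s d) y).
Proof.
move=> d0 mb bM.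
have d2 : 0 < d *+ 2 by rewrite mulrn_wgt0.
have ib := rint_ball_bounded d s mb bM.
have -> : mean b d s - b s = (d *+ 2)^-1 * \int[mu]_t (\1_(ball (0 : R) d) t * (b (s - t) - b s)).
  under eq_Rintegral do rewrite mulrBr.
  rewrite RintegralB; [|exact: measurableT|exact: ib|].
    rewrite RintegralZr; [|exact: measurableT|exact: rint_ball].
    by rewrite Rint_ball ?ltW// mulrBr mulrA mulVf ?mul1r// gt_eqF.
  under [X in _.-integrable _ X]eq_fun do rewrite /= mulrC.
  by apply: rintZ; exact: rint_ball.
rewrite normrM gtr0_norm ?invr_gt0// ler_wpM2l ?invr_ge0 ?(ltW d2)//.
have i1 : rint (fun t => \1_(ball (0 : R) d) t * (b (s - t) - b s)).
  under [X in rint X]funext do rewrite mulrBr [_ * b s]mulrC.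
  by apply: rintB => //; apply: rintZ; exact: rint_ball.
apply: (le_trans (abse_Rint i1)).
have m2 : measurable_fun setT (fun y => `|b y - b s| * \1_(ball s d) y).
  apply: measurable_funM; last exact: rint_measurable (rint_ball _ _).
  by apply: measurableT_comp => //; exact: measurable_funB.
rewrite -(Rint_subr s m2) le_eqVlt; apply/orP; left; apply/eqP.
apply: eq_Rintegral => t _; rewrite normrM mulrC; congr (_ * _).
by rewrite !indicE !in_ballE subr0 addrAC subrr sub0r normrN ger0_norm.
Qed.

Lemma mean_bounded b d s M : 0 < d -> measurable_fun setT b -> (forall x, `|b x| <= M) ->
  `|mean b d s| <= M.
Proof.
move=> d0 mb bM; have d2 : 0 < d *+ 2 by rewrite mulrn_wgt0.
have ib := rint_ball_bounded d s mb bM.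
rewrite /mean normrM gtr0_norm ?invr_gt0// ler_pdivrMl//.
apply: (le_trans (abse_Rint ib)).
rewrite -(Rint_ball 0 (ltW d0)) -RintegralZr; [|exact: measurableT|exact: rint_ball].
have iM : rint (fun t => \1_(ball (0 : R) d) t * M).
  by under [X in rint X]funext do rewrite mulrC; apply: rintZ; exact: rint_ball.
apply: le_Rintegral; [exact: measurableT|exact: rint_norm|exact: iM|].
by move=> t _; rewrite normrM ger0_norm// ler_wpM2l.
Qed.

Lemma mean_cvg b (s M : R) (d_ : nat -> R) : sqint b -> (forall x, `|b x| <= M) ->
  (forall n, 0 < d_ n) -> d_ @ \oo --> (0 : R) -> lebesgue_pt b s ->
  (fun n => mean b (d_ n) s) @ \oo --> b s.
Proof.
move=> sb bM d0 dcv bs; have [mb _] := sb.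
apply/cvgrPdist_le => e e0.
have /(_ e e0) small := lebesgue_pt_small sb bs.
have cr : d_ @ \oo --> (0 : R)^'+.
  move=> P HP; have HP' : \forall n \near \oo, 0 < d_ n -> P (d_ n) := dcv _ HP.
  by apply: filterS HP' => n; apply; exact: d0.
have small' : \forall n \near \oo,
    \int[mu]_y (`|b y - b s| * \1_(ball s (d_ n)) y) <= e * d_ n := cr _ small.
apply: filterS small' => n Hn.
rewrite distrC; apply: (le_trans (mean_dist s (d0 n) mb bM)).
rewrite ler_pdivrMl ?mulrn_wgt0//; apply: (le_trans Hn).
by rewrite mulrC ler_wpM2r ?(ltW e0)// mulr2n lerDl ltW.
Qed.

(** Fubini moves the mean over the shift [t] onto [b], whose means converge at its
    Lebesgue points; boundedness and compact support of [b] allow dominated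
    convergence with [k] merely square integrable. *)
Lemma mean_correlation_cvg b k (M N : R) : sqint b -> (forall x, `|b x| <= M) ->
  (forall x, N < `|x| -> b x = 0) -> sqint k ->
  let d_ (n : nat) : R := n.+1%:R^-1 in
  (forall n, rint (fun t => \1_(ball (0 : R) (d_ n)) t * \int[mu]_s (k s * b (s - t)))) /\
  (fun n : nat => (d_ n *+ 2)^-1 *
    \int[mu]_t (\1_(ball (0 : R) (d_ n)) t * \int[mu]_s (k s * b (s - t)))) @ \oo -->
  \int[mu]_s (k s * b s).
Proof.
move=> sb bM bN sk d_; have [mb _] := sb; have [mk _] := sk.
have d0 n : 0 < d_ n by rewrite invr_gt0 ltr0n.
have d1 n : d_ n <= 1 by rewrite invf_le1 ?ltr0n// ler1n.
pose I := `[- (N + 1), N + 1]%classic : set R.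
pose kI s := k s * \1_I s.
have ikI : rint kI by exact: rint_itv.
(* For [|t| < 1] the translate of [b] is supported in [I]. *)
have local n t : \1_(ball (0 : R) (d_ n)) t * \int[mu]_s (k s * b (s - t)) =
    \1_(ball (0 : R) (d_ n)) t * \int[mu]_s (kI s * b (s - t)).
  rewrite in_ball0; have [td|_] := ltP `|t| (d_ n); last by rewrite !mul0r.
  congr (_ * _); apply: eq_Rintegral => s _; rewrite /kI indicE.
  have [sI|] := boolP (s \in I); first by rewrite mulr1.
  rewrite mulr0 mul0r notin_setE /I /= in_itv /= -ler_norml => /negP.
  rewrite -ltNge => sN; rewrite bN ?mulr0//.
  have := ler_normB (s - t) (- t); rewrite opprK subrK normrN.
  have := lt_le_trans td (d1 n); lra.
have swap n := @Rint_swap R _ kI (fun z => b (z.2 - z.1)) M (rint_ball (0 : R) (d_ n)) ikI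
  (measurable_subz mb) (fun z => bM _).
split=> [n|].
  by have [i _] := swap n; under [X in rint X]funext do rewrite local.
have -> : (fun n : nat => (d_ n *+ 2)^-1 *
    \int[mu]_t (\1_(ball (0 : R) (d_ n)) t * \int[mu]_s (k s * b (s - t)))) =
    (fun n => \int[mu]_s (kI s * mean b (d_ n) s)).
  apply/funext => n; under eq_Rintegral do rewrite local.
  have [_ /= ->] := swap n.
  rewrite -RintegralZl; [|exact: measurableT|].
    by apply: eq_Rintegral => s _; rewrite /mean mulrCA.
  have msub : measurable_fun setT (fun z : R * R => b (z.1 - z.2)).
    apply: (measurableT_comp mb).
    by apply: measurable_funB; [exact: measurable_fst|exact: measurable_snd].
  have [+ _] := @Rint_swap R kI _ _ M ikI (rint_ball (0 : R) (d_ n)) msub (fun z => bM _).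
  exact.
have -> : \int[mu]_s (k s * b s) = \int[mu]_s (kI s * b s).
  apply: eq_Rintegral => s _; rewrite /kI indicE.
  have [sI|] := boolP (s \in I); first by rewrite mulr1.
  rewrite mulr0 mul0r notin_setE /I /= in_itv /= -ler_norml => /negP.
  by rewrite -ltNge => sN; rewrite bN ?mulr0//; lra.
have mkI := rint_measurable ikI.
apply: (@Rint_dominated _ _ (fun s => M * `|kI s|)).
- move=> n; apply: measurable_funM => //; apply: measurable_funM => //.
  apply: (@measurable_Rint_param _ (fun z => \1_(ball (0 : R) (d_ n)) z.2 * b (z.1 - z.2))).
  apply: measurable_funM.
    apply: (measurableT_comp (rint_measurable (rint_ball (0 : R) (d_ n)))).
    exact: measurable_snd.
  apply: (measurableT_comp mb).
  by apply: measurable_funB; [exact: measurable_fst|exact: measurable_snd].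
- exact: measurable_funM.
- apply: filterS (sqint_lebesgue_pt sb) => s bs; apply: cvgMr.
  by apply: (mean_cvg sb bM d0) => //; exact: cvg_harmonic.
- by apply: rintZ; exact: rint_norm.
- by move=> n s; rewrite normrM mulrC ler_wpM2r// mean_bounded.
Qed.

(** The means of [mean_correlation_cvg] only see almost every shift, and yet they
    converge to the value at shift 0. *)
Lemma ae_correlation_le b1 b2 k1 k2 (M N S : R) :
  sqint b1 -> sqint b2 -> (forall x, `|b1 x| <= M) -> (forall x, `|b2 x| <= M) ->
  (forall x, N < `|x| -> b1 x = 0) -> (forall x, N < `|x| -> b2 x = 0) ->
  sqint k1 -> sqint k2 ->
  {ae mu, forall t, \int[mu]_s (k1 s * b1 (s - t)) + \int[mu]_s (k2 s * b2 (s - t)) <= S} ->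
  \int[mu]_s (k1 s * b1 s) + \int[mu]_s (k2 s * b2 s) <= S.
Proof.
move=> sb1 sb2 M1 M2 N1 N2 sk1 sk2 le_S.
have [i1 c1] := mean_correlation_cvg sb1 M1 N1 sk1.
have [i2 c2] := mean_correlation_cvg sb2 M2 N2 sk2.
apply: (cvgr_to_le (cvgD c1 c2)); apply: nearW => n /=.
move: (i1 n) (i2 n) => /=; set d := (n.+1%:R^-1 : R) => j1 j2.
suff : (d *+ 2)^-1 * \int[mu]_t (\1_(ball (0 : R) d) t * \int[mu]_s (k1 s * b1 (s - t))) +
  (d *+ 2)^-1 * \int[mu]_t (\1_(ball (0 : R) d) t * \int[mu]_s (k2 s * b2 (s - t))) <= S.
  by [].
have d0 : 0 < d by rewrite invr_gt0 ltr0n.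
have ib := rint_ball (0 : R) d.
have iS : rint (fun t => \1_(ball (0 : R) d) t * S).
  by under [X in rint X]funext do rewrite mulrC; apply: rintZ.
rewrite -mulrDr ler_pdivrMl ?mulrn_wgt0//.
rewrite -(Rint_ball 0 (ltW d0)) -RintegralZr; [|exact: measurableT|exact: ib].
rewrite -RintegralD; [|exact: measurableT|exact: j1|exact: j2].
apply: le_Rint_ae => //; first exact: (rintD j1 j2).
by apply: filterS le_S => t leS; rewrite -mulrDr ler_wpM2l.
Qed.

End Averaging.

(** * The operator norm of a convolution filter *)

Section OperatorNorm.
Context {R : realType}.
Notation mu := (@lebesgue_measure R).
Implicit Types (f g h k x : R -> R[i]) (T : (R -> R[i]) -> (R -> R[i])).
Notation re f := (fun t => complex.Re (f t)).
Notation im f := (fun t => complex.Im (f t)).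
Notation normc := ComplexField.Normc.normc.

Lemma lebesgue_measureT_gt0 : (0 < mu setT)%E.
Proof.
apply: (@lt_le_trans _ _ (mu `[0, 1]%classic)).
  by rewrite lebesgue_measure_itv/= lte_fin ltr01 -EFinB subr0 lte_fin ltr01.
by apply: le_measure; rewrite ?inE.
Qed.

Lemma cnormoo_le f (c : R) : {ae mu, forall t, normc (f t) <= c} -> (cnorm +oo%E f <= c%:E)%E.
Proof.
move=> fc; rewrite /cnorm unlock lebesgue_measureT_gt0.
apply/ess_supP; apply: filterS fc => t ft /=.
by rewrite ger0_norm ?normc_ge0// lee_fin.
Qed.

Lemma cnormoo_ge f : {ae mu, forall t, ((normc (f t))%:E <= cnorm +oo%E f)%E}.
Proof.
rewrite /cnorm unlock lebesgue_measureT_gt0.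
apply: filterS (ess_sup_ge mu (abse \o (fun t => (normc (f t))%:E))) => t /=.
by rewrite ger0_norm ?normc_ge0.
Qed.

Lemma opnorm_conv_le T k : isLp 2%:E k ->
  (forall x, isLp 2%:E x -> T x = conv x k %[ae mu]) -> (opnorm T <= cnorm 2%:E k)%E.
Proof.
move=> kL Tk; apply: ge_ereal_sup => _ [x [xL x1] <-].
have /isLp2P[kr ki] := kL; have /isLp2P[xr xi] := xL.
rewrite (cnorm2E kr ki); apply: cnormoo_le.
apply: filterS (Tk x xL) => t -> //.
apply: (le_trans (conv_bound t xL kL)).
move: x1; rewrite (cnorm2E xr xi) lee_fin => x1.
by rewrite ler_piMl// sqrtr_ge0.
Qed.

Lemma opnorm_ge0 T : (0 <= opnorm T)%E.
Proof.
have s0 : sqint (fun=> 0 : R).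
  split=> //; apply: rint_le (rint_ball (0 : R) 1) => // t.
  by rewrite expr0n normr0.
have x0 : isLp 2%:E (fun=> 0 : R[i]) by exact/isLp2P.
apply: (@le_trans _ _ (cnorm +oo%E (T (fun=> 0)))); first exact: Lnorm_ge0.
apply: ereal_sup_ubound; exists (fun=> 0) => //; split => //.
by rewrite cnorm2E// /energy Rint_eq0 ?sqrtr0 ?lee_fin// => t; rewrite expr0n addr0.
Qed.

(** The input is the conjugate time reversal of [b1 + i b2], normalized: its
    response at time 0 is the integral on the left, and [ae_correlation_le] passes
    from the essential supremum to that time. *)
Lemma pairing_le_opnorm T k (b1 b2 : R -> R) (M N : R) : isLp 2%:E k ->
  (forall x, isLp 2%:E x -> T x = conv x k %[ae mu]) ->
  sqint b1 -> sqint b2 -> (forall s, `|b1 s| <= M) -> (forall s, `|b2 s| <= M) ->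
  (forall s, N < `|s| -> b1 s = 0) -> (forall s, N < `|s| -> b2 s = 0) ->
  ((\int[mu]_s (complex.Re (k s) * b1 s) + \int[mu]_s (complex.Im (k s) * b2 s))%:E <=
   opnorm T * (Num.sqrt (\int[mu]_s (b1 s ^+ 2 + b2 s ^+ 2)))%:E)%E.
Proof.
move=> kL Tk s1 s2 M1 M2 N1 N2.
have /isLp2P[kr ki] := kL.
set B := Num.sqrt _.
have ib : rint (fun s => b1 s ^+ 2 + b2 s ^+ 2) by apply: rintD; [case: s1|case: s2].
have [B0|] := ltP 0 B; last first.
  move=> Bn; have B0 : B = 0 by apply/eqP; rewrite eq_le Bn sqrtr_ge0.
  rewrite B0 mule0 lee_fin -RintegralD//; [|exact: sqint_mul|exact: sqint_mul].
  have := cauchy_schwarz kr ki s1 s2.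
  by rewrite -/B B0 mulr0 normr_le0 => /eqP ->.
pose x s : R[i] := (B^-1 * b1 (- s)) +i* (- B^-1 * b2 (- s)).
have xL : isLp 2%:E x.
  by apply/isLp2P; split; apply: sqintZ; exact: sqint_reflect.
have x1 : cnorm 2%:E x = 1%E.
  have /isLp2P[xr xi] := xL.
  rewrite cnorm2E//; congr EFin.
  rewrite /energy /=.
  under eq_Rintegral do rewrite !exprMn sqrrN -mulrDr.
  rewrite RintegralZl//; last by have := rint_reflect ib.
  rewrite (@Rint_reflect _ (fun s => b1 s ^+ 2 + b2 s ^+ 2)); last exact: rint_measurable.
  rewrite sqrtrM ?sqr_ge0// sqrtr_sqr gtr0_norm ?invr_gt0//.
  by rewrite mulVf// gt_eqF.
have Re_conv t : complex.Re (conv x k t) = B^-1 *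
    (\int[mu]_s (complex.Re (k s) * b1 (s - t)) + \int[mu]_s (complex.Im (k s) * b2 (s - t))).
  have i1 : rint (fun s => complex.Re (k s) * b1 (s - t)).
    by apply: sqint_mul => //; exact: sqint_shift.
  have i2 : rint (fun s => complex.Im (k s) * b2 (s - t)).
    by apply: sqint_mul => //; exact: sqint_shift.
  rewrite -RintegralD// -RintegralZl//; last exact: rintD.
  rewrite -[RHS](Rint_subr t); last by apply: rint_measurable; apply: rintZ; exact: rintD.
  rewrite /conv /cintegral /=; apply: eq_Rintegral => s _.
  by rewrite ReM /= addrAC subrr sub0r; ring.
have TxS : (cnorm +oo%E (T x) <= opnorm T)%E.
  by apply: ereal_sup_ubound; exists x => //; split => //; rewrite x1.
have S0 := opnorm_ge0 T.
have ae_le (S : R) : opnorm T = S%:E ->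
    {ae mu, forall t, \int[mu]_s (complex.Re (k s) * b1 (s - t)) +
      \int[mu]_s (complex.Im (k s) * b2 (s - t)) <= S * B}.
  move=> ES; rewrite ES in TxS.
  apply: filterS2 (Tk x xL) (cnormoo_ge (T x)) => t Txt /le_trans/(_ TxS).
  rewrite Txt// lee_fin => nS.
  have : complex.Re (conv x k t) <= S.
    apply: le_trans nS; apply: (le_trans (ler_norm _)).
    rewrite normcE -sqrtr_sqr ler_wsqrtr// lerDl sqr_ge0 //.
  by rewrite Re_conv ler_pdivrMl// mulrC.
case E : (opnorm T) S0 => [S| |] // S0; last by rewrite gt0_mulye ?lte_fin// leey.
rewrite -EFinM lee_fin; exact: ae_correlation_le s1 s2 M1 M2 N1 N2 kr ki (ae_le S E).
Qed.

(** The lower bound applies [pairing_le_opnorm] to [k] itself, cut off where its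
    argument or one of its components exceeds [n], and lets [n] tend to
    infinity. *)
Lemma opnorm_conv T k : isLp 2%:E k ->
  (forall x, isLp 2%:E x -> T x = conv x k %[ae mu]) -> opnorm T = cnorm 2%:E k.
Proof.
move=> kL Tk; apply/eqP; rewrite eq_le opnorm_conv_le//=.
have /isLp2P[kr ki] := kL; have [mkr _] := kr; have [mki _] := ki.
pose A (n : nat) : set R := `[- n%:R, n%:R]%classic `&`
  ((re k) @^-1` `[- n%:R, n%:R]%classic `&` (im k) @^-1` `[- n%:R, n%:R]%classic).
have mA n : measurable (A n).
  apply: measurableI => //; apply: measurableI.
    by rewrite -[X in measurable X]setTI; exact: mkr.
  by rewrite -[X in measurable X]setTI; exact: mki.
have inA n s : (s \in A n) =
    [&& `|s| <= n%:R, `|complex.Re (k s)| <= n%:R & `|complex.Im (k s)| <= n%:R].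
  apply/idP/idP => [|/and3P[]].
    by rewrite inE /A /= !in_itv/= -!ler_norml => -[-> [-> ->]].
  by rewrite inE /A /= !in_itv/= -!ler_norml => -> -> ->.
pose b n (f : R -> R) s := f s * \1_(A n) s.
pose e n s := (complex.Re (k s) ^+ 2 + complex.Im (k s) ^+ 2) * \1_(A n) s.
have matched n : ((\int[mu]_s e n s)%:E <= opnorm T * (Num.sqrt (\int[mu]_s e n s))%:E)%E.
  have bN (f : R -> R) s : n%:R < `|s| -> b n f s = 0.
    by move=> ns; rewrite /b indicE inA leNgt ns mulr0.
  have bM1 s : `|b n (re k) s| <= n%:R.
    rewrite /b indicE inA; case: and3P => [[_ k1 _]|_]; first by rewrite mulr1.
    by rewrite mulr0 normr0.
  have bM2 s : `|b n (im k) s| <= n%:R.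
    rewrite /b indicE inA; case: and3P => [[_ _ k1]|_]; first by rewrite mulr1.
    by rewrite mulr0 normr0.
  have s1 : sqint (b n (re k)) by exact: sqint_indic.
  have s2 : sqint (b n (im k)) by exact: sqint_indic.
  have := pairing_le_opnorm kL Tk s1 s2 bM1 bM2 (bN _) (bN _).
  rewrite -RintegralD//; [|exact: sqint_mul|exact: sqint_mul].
  rewrite (@eq_Rintegral _ _ _ mu setT (e n)); last first.
    by move=> s _; rewrite /e /b mulrDl; ring.
  rewrite (@eq_Rintegral _ _ _ mu setT (e n) (fun s => _ + b n _ _ ^+ 2))//.
  move=> s _; rewrite /e /b !exprMn -mulrDl indicE.
  by case: (_ \in _); rewrite ?expr1n ?expr0n.
have ie : rint (fun s => complex.Re (k s) ^+ 2 + complex.Im (k s) ^+ 2).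
  by apply: rintD; [case: kr|case: ki].
have cv : (fun n => \int[mu]_s e n s) @ \oo --> energy k.
  apply: (@Rint_dominated _ _ _ (fun s => complex.Re (k s) ^+ 2 + complex.Im (k s) ^+ 2)) => //.
  - move=> n; apply: measurable_funM; first exact: rint_measurable.
    exact: measurable_indic.
  - exact: rint_measurable.
  - apply: aeW => s; apply: cvg_near_cst; near=> n.
    have sA : s \in A n.
      by rewrite inA; apply/and3P; split; near: n; exact: nbhs_infty_ger.
    by rewrite /e indicE sA mulr1.
  - move=> n s; rewrite normrM ger0_norm ?addr_ge0 ?sqr_ge0//.
    by rewrite indicE; case: (_ \in _); rewrite ?normr1 ?normr0 ?mulr1 ?mulr0 ?addr_ge0 ?sqr_ge0.
rewrite cnorm2E//.
have [Tpos|] := ltP (opnorm T) +oo%E; last by apply: le_trans; exact: leey.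
have T0 : (0 <= opnorm T)%E.
  exact: opnorm_ge0.
case E : (opnorm T) T0 Tpos => [S| |] // S0 _; rewrite lee_fin in S0 *.
have eS n : \int[mu]_s e n s <= S ^+ 2.
  have := matched n; rewrite E -EFinM lee_fin.
  set i := \int[mu]_s _ => iS.
  have i0 : 0 <= i.
    by apply: Rintegral_ge0 => s _; rewrite mulr_ge0// addr_ge0// sqr_ge0.
  have := sqr_sqrtr i0; have := sqrtr_ge0 i; set q := Num.sqrt i in iS *; nra.
rewrite lee_fin -(ger0_norm S0) -sqrtr_sqr ler_wsqrtr//.
by apply: (cvgr_to_le cv); exact: nearW.
Unshelve. all: by end_near. Qed.

End OperatorNorm.

(** * Convolution filters *)

Section ConvolutionFilters.
Context {R : realType}.
Notation mu := (@lebesgue_measure R).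
Implicit Types (f g h k x y : R -> R[i]).
Notation re f := (fun t => complex.Re (f t)).
Notation im f := (fun t => complex.Im (f t)).
Notation normc := ComplexField.Normc.normc.

Lemma complex_eq (z w : R[i]) : complex.Re z = complex.Re w ->
  complex.Im z = complex.Im w -> z = w.
Proof. by case: z w => ? ? [? ?] /= -> ->. Qed.

Lemma ReB (z w : R[i]) : complex.Re (z - w) = complex.Re z - complex.Re w.
Proof. by case: z w => ? ? []. Qed.

Lemma ImB (z w : R[i]) : complex.Im (z - w) = complex.Im z - complex.Im w.
Proof. by case: z w => ? ? []. Qed.

Lemma ReD (z w : R[i]) : complex.Re (z + w) = complex.Re z + complex.Re w.
Proof. by case: z w => ? ? []. Qed.

Lemma ImD (z w : R[i]) : complex.Im (z + w) = complex.Im z + complex.Im w.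
Proof. by case: z w => ? ? []. Qed.

Lemma isLp2B h g : isLp 2%:E h -> isLp 2%:E g -> isLp 2%:E (fun t => h t - g t).
Proof.
move=> /isLp2P[hr hi] /isLp2P[gr gi]; apply/isLp2P; split.
  by under [X in sqint X]funext do rewrite ReB; exact: sqintB.
by under [X in sqint X]funext do rewrite ImB; exact: sqintB.
Qed.

Lemma conv_subr x h g t : isLp 2%:E x -> isLp 2%:E h -> isLp 2%:E g ->
  conv x (fun t => h t - g t) t = conv x h t - conv x g t.
Proof.
move=> xL hL gL.
have [ihr ihi] := isLp2_mul_rint xL (isLp2_subr t hL).
have [igr igi] := isLp2_mul_rint xL (isLp2_subr t gL).
apply: complex_eq; rewrite ?ReB ?ImB /conv /cintegral /=.
  rewrite -RintegralB//; apply: eq_Rintegral => s _.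
  by rewrite mulrBr ReB.
rewrite -RintegralB//; apply: eq_Rintegral => s _.
by rewrite mulrBr ImB.
Qed.

Lemma conv_linearl (a : R[i]) x y g t : isLp 2%:E x -> isLp 2%:E y -> isLp 2%:E g ->
  conv (fun t => a * x t + y t) g t = a * conv x g t + conv y g t.
Proof.
move=> xL yL gL.
have [ixr ixi] := isLp2_mul_rint xL (isLp2_subr t gL).
have [iyr iyi] := isLp2_mul_rint yL (isLp2_subr t gL).
apply: complex_eq; rewrite ?ReD ?ImD ?ReM ?ImM /conv /cintegral /=.
  rewrite -!RintegralZl// -RintegralB//; [|exact: rintZ|exact: rintZ].
  rewrite -RintegralD//; last by apply: rintB; exact: rintZ.
  by apply: eq_Rintegral => s _; rewrite mulrDl -mulrA ReD ReM.
rewrite -!RintegralZl// -RintegralD//; [|exact: rintZ|exact: rintZ].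
rewrite -RintegralD//; last by apply: rintD; exact: rintZ.
by apply: eq_Rintegral => s _; rewrite mulrDl -mulrA ImD ImM.
Qed.

Lemma conv_translate x g s t : isLp 2%:E x -> isLp 2%:E g ->
  conv (translate s x) g t = conv x g (t - s).
Proof.
move=> xL gL.
have [ir ii] := isLp2_mul_rint xL (isLp2_subr (t - s) gL).
rewrite /conv /cintegral; congr (_ +i* _).
  rewrite -(Rint_shift (- s) (rint_measurable ir)); apply: eq_Rintegral => u _.
  by rewrite /translate; congr (complex.Re (_ * g _)); ring.
rewrite -(Rint_shift (- s) (rint_measurable ii)); apply: eq_Rintegral => u _.
by rewrite /translate; congr (complex.Im (_ * g _)); ring.
Qed.

Lemma conv_ae x y g t : isLp 2%:E x -> isLp 2%:E y -> isLp 2%:E g ->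
  x = y %[ae mu] -> conv x g t = conv y g t.
Proof.
move=> xL yL gL xy.
have [ixr ixi] := isLp2_mul_rint xL (isLp2_subr t gL).
have [iyr iyi] := isLp2_mul_rint yL (isLp2_subr t gL).
rewrite /conv /cintegral; congr (_ +i* _); apply: ae_eq_Rint; try exact: rint_measurable.
  by apply: filterS xy => s ->.
by apply: filterS xy => s ->.
Qed.

Lemma measurable_conv x g : isLp 2%:E x -> isLp 2%:E g ->
  measurable_fun setT (re (conv x g)) /\ measurable_fun setT (im (conv x g)).
Proof.
move=> [xr xi _] [gr gi _].
have m2 (f : R -> R) : measurable_fun setT f ->
    measurable_fun setT (fun z : R * R => f z.2).
  by move=> mf; apply: (measurableT_comp mf); exact: measurable_snd.
have md (f : R -> R) : measurable_fun setT f ->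
    measurable_fun setT (fun z : R * R => f (z.1 - z.2)).
  move=> mf; apply: (measurableT_comp mf).
  by apply: measurable_funB; [exact: measurable_fst|exact: measurable_snd].
split.
  apply: (@measurable_Rint_param _ (fun z : R * R => complex.Re (x z.2 * g (z.1 - z.2)))).
  under eq_fun do rewrite ReM.
  apply: measurable_funB; apply: measurable_funM.
  - exact: m2 xr.
  - exact: md gr.
  - exact: m2 xi.
  - exact: md gi.
apply: (@measurable_Rint_param _ (fun z : R * R => complex.Im (x z.2 * g (z.1 - z.2)))).
under eq_fun do rewrite ImM.
apply: measurable_funD; apply: measurable_funM.
- exact: m2 xr.
- exact: md gi.
- exact: m2 xi.
- exact: md gr.
Qed.

Section ConvFilter.
Variables (g : R -> R[i]) (gL : isLp 2%:E g).

Let conv_Loo x : isLp 2%:E x -> isLp +oo%E (conv x g).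
Proof.
move=> xL; have [mr mi] := measurable_conv xL gL; split => //.
apply: (@le_lt_trans _ _ (Num.sqrt (energy x) * Num.sqrt (energy g))%:E); last exact: ltry.
by apply: cnormoo_le; apply: aeW => t; exact: conv_bound.
Qed.

Let conv_bounded : exists C : R, forall x, isLp 2%:E x ->
  (cnorm +oo (conv x g) <= C%:E * cnorm 2%:E x)%E.
Proof.
exists (Num.sqrt (energy g)) => x xL; have /isLp2P[xr xi] := xL.
rewrite cnorm2E// -EFinM mulrC.
by apply: cnormoo_le; apply: aeW => t; exact: conv_bound.
Qed.

Definition convFilter : analogFilter R := @AnalogFilter R (fun x => conv x g)
  conv_Loo
  (fun x y xL yL xy => aeW mu (fun t _ => conv_ae t xL yL gL xy))
  (fun a x y xL yL => aeW mu (fun t _ => conv_linearl a t xL yL gL))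
  conv_bounded
  (fun s x xL => aeW mu (fun t _ => conv_translate s t xL gL)).

End ConvFilter.

Lemma opnorm_subr (L K : analogFilter R) h g : isLp 2%:E h -> isLp 2%:E g ->
  is_conv_filter L h -> is_conv_filter K g ->
  opnorm (fun x t => L x t - K x t) = cnorm 2%:E (fun t => h t - g t).
Proof.
move=> hL gL Lh Kg; apply: opnorm_conv; first exact: isLp2B.
move=> x xL; apply: filterS2 (Lh x xL) (Kg x xL) => t /= Lt Kt tT.
by rewrite Lt// Kt// conv_subr.
Qed.

End ConvolutionFilters.

(** * Distance to the causal filters *)

Section CausalProjection.
Context {R : realType}.
Notation mu := (@lebesgue_measure R).
Implicit Types (g h : R -> R[i]).

Notation sq h := (fun t => complex.Re (h t) ^+ 2 + complex.Im (h t) ^+ 2).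

Lemma rint_sq h : isLp 2%:E h -> rint (sq h).
Proof. by move=> /isLp2P[[_ ?] [_ ?]]; exact: rintD. Qed.

Definition negative_energy h :=
  \int[mu]_t ((complex.Re (h t) ^+ 2 + complex.Im (h t) ^+ 2) * \1_(`]-oo, 0[) t).

Lemma rint_indicM (f : R -> R) (A : set R) : measurable A -> rint f ->
  rint (fun t => f t * \1_A t).
Proof.
move=> mA fi; apply: (@rintM_bounded _ _ _ 1) => // t.
by rewrite indicE; case: (_ \in _); rewrite /= ?normr1 ?normr0.
Qed.

Lemma ae_neq0 : {ae mu, forall t : R, t != 0}.
Proof.
exists [set 0]; split => //; first exact: lebesgue_measure_set1.
by move=> t /= /negP; rewrite negbK => /eqP.
Qed.

(** [|h|] is even almost everywhere, so the two half-lines carry the same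
    energy. *)
Lemma hermitian_negative_energy h : isLp 2%:E h ->
  {ae mu, forall t, complex.Re (h (- t)) = complex.Re (h t) /\
                    complex.Im (h (- t)) = - complex.Im (h t)} ->
  negative_energy h = energy h / 2.
Proof.
move=> hL hh; have i := rint_sq hL; have mi := rint_measurable i.
have in_ : rint (fun t => sq h t * \1_(`]-oo, 0[) t) by exact: rint_indicM.
have ip : rint (fun t => sq h t * \1_(`[0, +oo[) t) by exact: rint_indicM.
have pos : \int[mu]_t (sq h t * \1_(`[0, +oo[) t) = negative_energy h.
  rewrite -(Rint_reflect (rint_measurable ip)).
  apply: ae_eq_Rint; [exact: rint_measurable (rint_reflect ip)|exact: rint_measurable|].
  apply: filterS2 hh ae_neq0 => t [-> ->] t0; rewrite sqrrN; congr (_ * _).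
  by rewrite !indicE !mem_setE !in_itv /= andbT oppr_ge0 le_eqVlt (negbTE t0).
have : energy h = negative_energy h + \int[mu]_t (sq h t * \1_(`[0, +oo[) t).
  rewrite -RintegralD//; apply: eq_Rintegral => t _.
  rewrite -mulrDr !indicE !mem_setE !in_itv /= andbT.
  by case: ltP; rewrite ?addr0 ?add0r mulr1.
by rewrite pos => ->; field.
Qed.

(** On the negative half-line [h - g] is [h]. *)
Lemma causal_energy_ge h g : isLp 2%:E h -> isLp 2%:E g ->
  {ae mu, forall t, t < 0 -> g t = 0} ->
  negative_energy h <= energy (fun t => h t - g t).
Proof.
move=> hL gL g0; have dL := isLp2B hL gL.
apply: le_Rint_ae; [by apply: rint_indicM => //; exact: rint_sq|exact: (rint_sq dL)|].
apply: filterS g0 => t gt0; rewrite indicE mem_setE in_itv/=.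
have [t0|_] := ltP t 0; first by rewrite mulr1 gt0// subr0.
by rewrite mulr0 addr_ge0// sqr_ge0.
Qed.

Definition causal_part h : R -> R[i] := fun t => if t < 0 then 0 else h t.

Lemma causal_part_isLp h : isLp 2%:E h -> isLp 2%:E (causal_part h).
Proof.
have E (F : R[i] -> R) : F 0 = 0 ->
    (fun t => F (causal_part h t)) = (fun t => F (h t) * \1_(`[0, +oo[) t).
  move=> F0; apply/funext => t; rewrite /causal_part indicE mem_setE in_itv/= andbT.
  by case: ltP; rewrite ?mulr0 ?mulr1.
move=> /isLp2P[hr hi]; apply/isLp2P; split.
  by rewrite (E (@complex.Re R))//; exact: sqint_indic.
by rewrite (E (@complex.Im R))//; exact: sqint_indic.
Qed.

Lemma causal_part_energy h : energy (fun t => h t - causal_part h t) = negative_energy h.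
Proof.
apply: eq_Rintegral => t _; rewrite /causal_part indicE mem_setE in_itv/=.
by case: ltP; rewrite ?subr0 ?mulr1// subrr /= expr0n addr0 mulr0.
Qed.

(** Restricting [h] to the nonnegative half-line is the orthogonal projection onto
    the causal impulse responses, and it attains the infimum. *)
Lemma filter_dist_causal (L : analogFilter R) h : isLp 2%:E h -> is_conv_filter L h ->
  filter_dist L (CFa R) = (Num.sqrt (negative_energy h))%:E.
Proof.
move=> hL Lh; apply/eqP; rewrite eq_le; apply/andP; split.
  have cL := causal_part_isLp hL.
  have Kc : is_conv_filter (convFilter cL) (causal_part h) by move=> x xL; apply: aeW.
  apply: ereal_inf_lbound; exists (convFilter cL).
    exists (causal_part h); split => //.
    by apply: aeW => t t0; rewrite /causal_part t0.
  rewrite (opnorm_subr hL cL Lh Kc).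
  have /isLp2P[r i] := isLp2B hL cL.
  by rewrite cnorm2E// causal_part_energy.
apply: le_ereal_inf_tmp => _ [K [g [gL g0 Kg]] <-].
rewrite (opnorm_subr hL gL Lh Kg).
have /isLp2P[r i] := isLp2B hL gL.
by rewrite cnorm2E// lee_fin ler_wsqrtr// causal_energy_ge.
Qed.

End CausalProjection.

Lemma asin_sqrt2V {R : realType} : asin (Num.sqrt 2)^-1 = pi / 4 :> R.
Proof.
have p0 := pi_gt0 R.
have s0 : 0 <= sin (pi / 4) :> R by apply: sin_ge0_pi; apply/andP; split; lra.
have -> : (Num.sqrt 2)^-1 = sin (pi / 4) :> R.
  rewrite -[RHS]ger0_norm// -sqrtr_sqr -sqrtrV//; congr Num.sqrt.
  have := cos_pihalf R; rewrite (_ : pi / 2 = (pi / 4) *+ 2).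
    by rewrite cos_mulr2n cos2sin2 mulr2n; lra.
  by field.
by apply: sinK; rewrite in_itv/=; apply/andP; split; lra.
Qed.

Theorem theorem4 (R : realType) (L : analogFilter R) (H : R -> R[i])
    (HL : is_transfer_function L H)
    (H_real : \forall w \ae @lebesgue_measure R, complex.Im (H w) = 0) :
  filter_dist L (CFa R) = (((Num.sqrt 2)^-1)%:E * opnorm L)%E /\
  (opnorm L != 0%E -> filter_angle L (CFa R) = pi / 4).
Proof.
have [h [hL Lh hF]] := HL.
have /isLp2P[hr hi] := hL.
have normL : opnorm L = (Num.sqrt (energy h))%:E.
  by rewrite (opnorm_conv hL Lh) cnorm2E.
have dist : filter_dist L (CFa R) = (((Num.sqrt 2)^-1)%:E * opnorm L)%E.
  rewrite (filter_dist_causal hL Lh).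
  rewrite hermitian_negative_energy//; last exact: fourier_real_symmetry hF H_real.
  by rewrite normL -EFinM sqrtrM ?energy_ge0// sqrtrV// mulrC.
split => // nz.
rewrite /filter_angle dist normL -EFinM /= mulfK; last first.
  by apply: contra_neq nz; rewrite normL => ->.
exact: asin_sqrt2V.
Qed.
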